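(* Let $\Bbbk$ be a field, let $\Delta$ be a simplicial complex on $[n]$ with $\dim \Delta=1$, let $S=\Bbbk[x_1,\dots,x_n]$, and let $\ell\geq1$. Then $$\mathrm{depth}(S/I_{\Delta}^{(\ell)})\geq\mathrm{depth}(S/I_{\Delta}^{(\ell+1)}).$$ Moreover, if $\Delta$ is pure, then $$S_{2}\text{-}\mathrm{depth}(S/I_{\Delta}^{(\ell)})\geq S_{2}\text{-}\mathrm{depth}(S/I_{\Delta}^{(\ell+1)}).$$
   Context: $\mathfrak m=(x_1,\dots,x_n)$ and $\omega_S$ is the canonical module of $S$. For an unmixed finitely generated graded $S$-module $M$ and $r\ge 2$, $S_r\text{-}\mathrm{depth}(M)=\min\{j : \dim K_M^j\ge j-r+1\}$, where $K_M^j=\mathrm{Hom}_{\Bbbk}(H^j_{\mathfrak m}(M),\Bbbk)\cong \mathrm{Ext}_S^{n-j}(M,\omega_S)$, $\dim$ is Krull dimension, and $\dim 0=-\infty$. A simplicial complex $\Delta$ on $[n]$ is a nonempty collection of subsets of $[n]$ closed under taking subsets (not every $\{i\}$ need be in $\Delta$); $\dim F=|F|-1$; $\Delta$ is pure if all facets have the same dimension. $I_\Delta\subset S$ is generated by the squarefree monomials corresponding to (minimal) non-faces of $\Delta$. For a squarefree monomial ideal $I$, the $\ell$-th symbolic power is $I^{(\ell)}=\bigcap_{P\in\mathrm{Ass}(I)}P^\ell$. *)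

(* Defs.v *)
From HB Require Import structures.
From mathcomp Require Import all_boot all_order all_algebra.
(* mpoly has to be imported before the mathcomp-analysis files: in the other
   order their notations clash. *)
From mathcomp Require Import mpoly.
From mathcomp Require Import boolp classical_sets constructive_ereal.

Set Implicit Arguments.
Unset Strict Implicit.
Unset Printing Implicit Defensive.

Import Order.TTheory GRing.Theory Num.Theory.

Local Open Scope classical_set_scope.
Local Open Scope ring_scope.

Section Ideals.
Variable R : comNzRingType.
Implicit Types (A I P : set R).

Definition ideal_gen A : set R :=
  [set f | exists (m : nat) (a g : 'I_m -> R),
     (forall i, A (g i)) /\ f = \sum_(i < m) a i * g i].

Definition ideal_pow P (l : nat) : set R :=
  ideal_gen [set \prod_(i < l) g i | g in [set g : 'I_l -> R | forall i, P (g i)]].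

(* idealr_closed includes properness: 1 is not in P. *)
Definition prime_ideal P : Prop :=
  idealr_closed (mem P) /\ prime_idealr_closed (mem P).

(* Ass(I) is the set of associated primes of the module R/I. *)
Definition Ass I : set (set R) :=
  [set P | prime_ideal P /\ exists f, P = [set g | I (g * f)]].

Definition symbolic_power I (l : nat) : set R :=
  \bigcap_(P in Ass I) ideal_pow P l.

Definition prime_chain A (d : nat) (C : nat -> set R) : Prop :=
  (forall i, (i <= d)%N -> prime_ideal (C i) /\ A `<=` C i) /\
  (forall i, (i < d)%N -> C i `<` C i.+1).

(* Krull dimension of R/A, hence of any finitely generated R-module with
   annihilator A. It is -oo if A contains 1, i.e. if the module is zero. *)
Definition krull_dim A : \bar int :=
  supremum (-oo%E : \bar int)
    [set (d%:Z)%:E | d in [set d : nat | exists C, prime_chain A d C]].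

(* fs is a regular sequence on the R-module R/I. *)
Definition regular_sequence I (fs : seq R) : Prop :=
  (forall i, (i < size fs)%N -> forall g,
     let J := ideal_gen (I `|` [set` take i fs]) in
     J (fs`_i * g) -> J g) /\
  ~ ideal_gen (I `|` [set` fs]) 1.

End Ideals.

Section Polynomials.
Variables (k : fieldType) (n : nat).
Local Notation S := {mpoly k[n]}.
Local Notation Q := {fraction S}.
Implicit Types (I : set S) (F G : {set 'I_n}) (j r : nat).

Definition max_ideal : set S := ideal_gen (range (fun i : 'I_n => 'X_i : S)).

Definition var_prod F : S := \prod_(i in F) 'X_i.

(* depth (S/I): the supremum of the lengths of the (S/I)-regular sequences in
   (x_1, ..., x_n); the zero module has depth +oo. *)
Definition depth I : \bar int :=
  supremum (+oo%E : \bar int)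
    [set ((size fs)%:Z)%:E | fs in
       [set fs : seq S | (forall f, f \in fs -> max_ideal f) /\
                         regular_sequence I fs]].

(* The Cech complex of S/I with respect to x_1, ..., x_n. Its component at a
   set F of variables is the localization
     (S/I)_{x_F} = loc setT F / loc I F,    x_F = var_prod F,
   where loc I F, the extension of the ideal I to the localization
   loc setT F = S_{x_F}, lives in the fraction field of S. *)
Definition loc I F : set Q :=
  [set q | exists p t, I p /\ q = tofrac p / tofrac (var_prod F) ^+ t].

Definition cech_cochain := {ffun {set 'I_n} -> Q}.
Implicit Types (u v : cech_cochain).

Definition cech_diff u : cech_cochain :=
  [ffun G : {set 'I_n} =>
    \sum_(i in G) (-1) ^+ #|[pred h in G | (h < i)%N]| * u (G :\ i)%SET].

Definition cech_scale (f : S) u : cech_cochain :=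
  [ffun F => tofrac f * u F].

(* Lifts to the localizations of S of the elements of the j-th term of the
   Cech complex of S/I; a lift represents 0 if all its components are in the
   localizations of I. *)
Definition cech_deg j u : Prop :=
  forall F, if #|F| == j then loc setT F (u F) else u F = 0.

Definition cech_cocycle I j u : Prop :=
  cech_deg j u /\ forall G, #|G| = j.+1 -> loc I G (cech_diff u G).

(* v ranges over the whole Cech complex, but only its component of degree
   j - 1 matters; for j = 0 the sum cech_diff v set0 is empty. *)
Definition cech_coboundary I j u : Prop :=
  cech_deg j u /\
  exists v, (forall F, loc setT F (v F)) /\
            forall F, #|F| = j -> loc I F (u F - cech_diff v F).

Definition frac_homog (d : int) (q : Q) : Prop :=
  exists (p s : S) (dp ds : nat),
    [/\ p \is dp.-homog, s \is ds.-homog, s != 0,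
        q = tofrac p / tofrac s & d = dp%:Z - ds%:Z].

Definition cech_homog (d : int) u : Prop := forall F, frac_homog d (u F).

(* K^j = Hom_k(H^j_m(S/I), k), H^j_m(S/I) being the cohomology of the Cech
   complex. As usual for graded modules, Hom_k is the graded dual: the direct
   sum of the duals of the graded components, i.e. the functionals that vanish
   in all but finitely many degrees. A functional on H^j_m(S/I) is represented
   by a map whose values outside the cocycles are irrelevant. *)
Definition lc_dual I j : set (cech_cochain -> k) :=
  [set phi |
    [/\ forall (a : k) u v, cech_cocycle I j u -> cech_cocycle I j v ->
          phi (cech_scale a%:MP u + v) = a * phi u + phi v,
        forall u, cech_coboundary I j u -> phi u = 0
      & exists N : int, forall d u, N < `|d| ->
          cech_cocycle I j u -> cech_homog d u -> phi u = 0]].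

(* S acts on K^j by (f . phi) u = phi (f . u). *)
Definition lc_dual_ann I j : set S :=
  [set f | forall phi, lc_dual I j phi ->
     forall u, cech_cocycle I j u -> phi (cech_scale f u) = 0].

Definition lc_dual_dim I j : \bar int := krull_dim (lc_dual_ann I j).

(* S_r-depth (S/I); the infimum is the minimum if the set is nonempty, and
   +oo otherwise. *)
Definition Sr_depth r I : \bar int :=
  infimum (+oo%E : \bar int)
    [set (j%:Z)%:E | j in
       [set j : nat | ((j%:Z - r%:Z + 1)%:E <= lc_dual_dim I j)%E]].

End Polynomials.

Section SimplicialComplexes.
Variable n : nat.
Implicit Types (D : {set {set 'I_n}}) (F G : {set 'I_n}).

Definition simplicial_complex D : Prop :=
  (exists F, F \in D) /\ forall F G, F \in D -> G \subset F -> G \in D.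

Definition face_dim F : int := #|F|%:Z - 1.

(* The maximum of the face_dim F, for D nonempty. *)
Definition complex_dim D : int := (\max_(F in D) #|F|)%:Z - 1.

Definition facet D F : Prop :=
  F \in D /\ forall G, G \in D -> F \subset G -> G = F.

Definition pure_complex D : Prop :=
  forall F G, facet D F -> facet D G -> face_dim F = face_dim G.

Definition stanley_reisner (k : fieldType) D : set {mpoly k[n]} :=
  ideal_gen [set var_prod k F | F in [set F | F \notin D]].

End SimplicialComplexes.

Arguments stanley_reisner {n} k D _.

(* Main.v *)
(* The symbolic powers of a Stanley-Reisner ideal are monomial: I^(l) consists of
   the polynomials whose monomials have weight at least l outside every facet.
   The ring S/I^(l) has dimension 2 and H^0_m = 0, so that both its depth and
   (for D pure) its S_2-depth are 1 or 2, and they are 1 exactly if H^1_m is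
   nonzero. By Takayama's formula this happens if and only if, for some
   exponent b, the facets outside of which b has weight less than l can be split
   into two nonempty families with disjoint unions. Such a splitting for l gives
   one for l + 1: an isolated vertex v always splits off; for l = 1 and D pure the
   exponent e_i + e_j works, with i and j on different sides; for l >= 2 and D pure
   a splitting forces a vertex v not adjacent to an edge G (otherwise any
   two disjoint edges lie in a 4-cycle, two opposite sides of which reconnect
   them), for which the exponent l v + G splits at level l + 1. *)

Require Import Defs.
From mathcomp Require Import all_boot all_order all_algebra.
From mathcomp Require Import zify ring.
From mathcomp Require Import mpoly.
From mathcomp Require Import boolp classical_sets constructive_ereal.

Set Implicit Arguments.
Unset Strict Implicit.
Unset Printing Implicit Defensive.

Import Order.TTheory GRing.Theory Num.Theory.

Local Open Scope classical_set_scope.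
Local Open Scope ring_scope.

(** * Ideals and symbolic powers *)

Section IdealTheory.
Variable R : comNzRingType.
Implicit Types (A I P : set R).

(** Takayama's formula only guides the proof. One half of it becomes an explicit class: a splitting
    at the exponent [b] yields a 1-cocycle with values x^b or 0, detected by a functional that reads
    coefficients at [b]. The other half becomes [glue]: if level [l] is connected, fractions p_i /
    x_i^t that agree modulo the l-th power of each facet prime come from a single polynomial. The
    two invariants are defined differently, by regular sequences and by dimensions of the duals K^j,
    and both rely on this gluing: for K^1 = 0, and for the regularity of the second member of an
    explicit regular sequence. Upper bounds on the depth come from the vanishing of Cech cohomology
    below the length of a regular sequence, which is proved directly on cochains. Since I^(l) is an
    intersection of ideals primary to the facet primes, membership is always tested one facet at a
    time. *)

Definition ideal I : Prop :=
  [/\ I 0, forall p q, I p -> I q -> I (p + q) & forall a p, I p -> I (a * p)].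

Lemma idealN I p : ideal I -> I p -> I (- p).
Proof. by case=> _ _ IM Ip; rewrite -mulN1r; apply: IM. Qed.

Lemma idealB I p q : ideal I -> I p -> I q -> I (p - q).
Proof. by move=> iI Ip Iq; case: (iI) => _ ID _; apply: ID => //; apply: idealN. Qed.

Lemma idealD I p q : ideal I -> I p -> I q -> I (p + q).
Proof. by case=> _ ID _; apply: ID. Qed.

Lemma idealMl I a p : ideal I -> I p -> I (a * p).
Proof. by case=> _ _; apply. Qed.

Lemma idealMr I p q : ideal I -> I p -> I (p * q).
Proof. by case=> _ _ IM Ip; rewrite mulrC; apply: IM. Qed.

Lemma ideal_sum I (T : Type) (r : seq T) (Q : pred T) (f : T -> R) :
  ideal I -> (forall i, Q i -> I (f i)) -> I (\sum_(i <- r | Q i) f i).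
Proof. by case=> I0 ID _ If; elim/big_ind: _. Qed.

Lemma ideal_gen_ideal A : ideal (ideal_gen A).
Proof.
split.
- by exists 0%N, (fun=> 0), (fun=> 0); split; [case|rewrite big_ord0].
- move=> p q [m1 [a1 [g1 [Ag1 ->]]]] [m2 [a2 [g2 [Ag2 ->]]]].
  exists (m1 + m2)%N.
  exists (fun i => match split i with inl j => a1 j | inr j => a2 j end).
  exists (fun i => match split i with inl j => g1 j | inr j => g2 j end).
  split=> [i|]; first by case: (split i).
  rewrite big_split_ord /=; congr (_ + _); apply: eq_bigr => i _.
    by rewrite (unsplitK (inl i)).
  by rewrite (unsplitK (inr i)).
- move=> b p [m [a [g [Ag ->]]]]; exists m, (fun i => b * a i), g; split=> //.
  by rewrite mulr_sumr; apply: eq_bigr => i _; rewrite mulrA.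
Qed.

Lemma sub_ideal_gen A : A `<=` ideal_gen A.
Proof.
move=> p Ap; exists 1%N, (fun=> 1), (fun=> p).
by split=> //; rewrite big_ord1 mul1r.
Qed.

Lemma ideal_gen_min A I : ideal I -> A `<=` I -> ideal_gen A `<=` I.
Proof.
move=> iI AI p [m [a [g [Ag ->]]]]; apply: ideal_sum => // i _.
by case: iI => _ _; apply; apply: AI.
Qed.

Lemma ideal_gen_id I : ideal I -> ideal_gen I = I.
Proof.
move=> iI; apply/seteqP; split; last exact: sub_ideal_gen.
exact: ideal_gen_min.
Qed.

Lemma ideal_pow0 P p : ideal_pow P 0 p.
Proof.
rewrite -(mulr1 p); apply: (idealMl _ (ideal_gen_ideal _)); apply: sub_ideal_gen.
by exists (fun=> 0); [case|rewrite big_ord0].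
Qed.

Lemma ideal_powS P l p q :
  P p -> ideal_pow P l q -> ideal_pow P l.+1 (p * q).
Proof.
move=> Pp [m [a [g [Ag ->]]]]; exists m, a, (fun i => p * g i); split.
  move=> i; have [h Ph <-] := Ag i.
  exists (fun j => if unlift ord0 j is Some j' then h j' else p).
    by move=> j /=; case: unliftP => [j' _|_].
  rewrite big_ord_recl unlift_none; congr (_ * _).
  by apply: eq_bigr => j _; rewrite liftK.
by rewrite mulr_sumr; apply: eq_bigr => i _; rewrite mulrCA.
Qed.

Lemma prime_ideal_ideal P : prime_ideal P -> ideal P.
Proof.
case=> -[/set_mem P0 _ PD] _; split=> //.
- move=> p q Pp Pq; have := PD 1 p q (mem_set Pp) (mem_set Pq).
  by rewrite mul1r => /set_mem.
- move=> a p Pp; have := PD a p 0 (mem_set Pp) (mem_set P0).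
  by rewrite addr0 => /set_mem.
Qed.

Lemma prime_ideal1 P : prime_ideal P -> ~ P 1.
Proof. by case=> -[_ /negP P1 _] _ H; apply: P1; apply/mem_set. Qed.

Lemma prime_idealM P p q : prime_ideal P -> P (p * q) -> P p \/ P q.
Proof.
by case=> _ H /mem_set/H/orP[] /set_mem ?; [left|right].
Qed.

Lemma prime_idealP P : ideal P -> ~ P 1 ->
  (forall p q, P (p * q) -> P p \/ P q) -> prime_ideal P.
Proof.
move=> iP P1 PM; case: (iP) => P0 PD PS; split; [split|].
- exact/mem_set.
- by apply/negP => /set_mem.
- move=> a p q /set_mem Pp /set_mem Pq; apply/mem_set/PD => //; exact: PS.
- move=> p q /set_mem/PM[] ?; apply/orP; [left|right]; exact/mem_set.
Qed.

End IdealTheory.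

(** * Powers of the primes generated by the variables outside a set *)

Section Thick.
Variables (k : fieldType) (n : nat).
Local Notation S := {mpoly k[n]}.
Implicit Types (F G : {set 'I_n}) (m : 'X_{1..n}) (p q f g : S).

Definition wt F m : nat := \sum_(i in ~: F) m i.

Lemma wtD F m1 m2 : wt F (m1 + m2) = (wt F m1 + wt F m2)%N.
Proof. by rewrite -big_split; apply: eq_bigr => i _; rewrite mnmDE. Qed.

Lemma wt0 F : wt F 0%MM = 0%N.
Proof. by rewrite /wt big1 // => i _; rewrite mnm0E. Qed.

Lemma wtMn F m t : wt F (m *+ t)%MM = (wt F m * t)%N.
Proof. by rewrite /wt big_distrl; apply: eq_bigr => i _; rewrite mulmnE. Qed.

Lemma wtU F i : wt F U_(i)%MM = (i \notin F).
Proof.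
rewrite /wt; case: (boolP (i \in F)) => iF /=.
  by rewrite big1 // => j; rewrite inE mnm1E; case: eqP => // <-; rewrite iF.
rewrite (bigD1 i) ?inE //= mnm1E eqxx big1 // => j /andP[_ /negPf].
by rewrite mnm1E eq_sym => ->.
Qed.

(* The l-th power of the prime ideal generated by the variables outside F. *)
Definition thick F (l : nat) : set S :=
  [set p | forall m, m \in msupp p -> (l <= wt F m)%N].

Lemma thickP F l p :
  thick F l p <-> (forall m, (wt F m < l)%N -> p@_m = 0).
Proof.
split=> H m.
  by move=> lm; apply: memN_msupp_eq0; apply/negP => /H; rewrite leqNgt lm.
by rewrite leqNgt; apply: contraL => /H; rewrite mcoeff_msupp => ->; rewrite eqxx.
Qed.

Lemma thickM F a b p q : thick F a p -> thick F b q -> thick F (a + b) (p * q).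
Proof.
move=> Hp Hq m /msuppM_le /allpairsP[[m1 m2] /= [/Hp h1 /Hq h2 ->]].
by rewrite wtD leq_add.
Qed.

Lemma thick_le F a b p : (a <= b)%N -> thick F b p -> thick F a p.
Proof. by move=> ab H m /H; apply: leq_trans. Qed.

Lemma thick0 F p : thick F 0 p.
Proof. by []. Qed.

Lemma thick_ideal F l : ideal (thick F l).
Proof.
split.
- by move=> m; rewrite msupp0.
- by move=> p q /thickP Hp /thickP Hq; apply/thickP => m lm; rewrite mcoeffD Hp ?Hq ?addr0.
- by move=> a p Hp; rewrite -(add0n l); apply: thickM => //; apply: thick0.
Qed.

Lemma thickX F l m : thick F l 'X_[m] <-> (l <= wt F m)%N.
Proof.
split=> [|lm m']; last by move=> /mem_msuppXP <-.
by apply; rewrite msuppX inE.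
Qed.

Definition part (P : pred 'X_{1..n}) p : S :=
  \sum_(m <- msupp p | P m) p@_m *: 'X_[m].

Lemma mcoeff_part P p m : (part P p)@_m = if P m then p@_m else 0.
Proof.
rewrite /part raddf_sum /=.
under eq_bigr => m' _ do rewrite mcoeffZ mcoeffX.
case: (boolP (m \in msupp p)) => mp.
  rewrite -big_filter; case: ifP => Pm.
    rewrite (bigD1_seq m) ?mem_filter ?Pm ?mp ?filter_uniq ?msupp_uniq //=.
    rewrite eqxx mulr1 big1 ?addr0 // => i /negPf ->; exact: mulr0.
  rewrite big1_seq // => i; rewrite mem_filter => /andP[_ /andP[Pi _]].
  by case: eqP => [E|_]; rewrite ?mulr0 //; move: Pi; rewrite E Pm.
rewrite (memN_msupp_eq0 mp) if_same big1_seq // => i /andP[_ ip].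
by case: eqP => [E|_]; rewrite ?mulr0 //; move: mp; rewrite -E ip.
Qed.

(* With d the least weight of a monomial of g, the product of the parts of
   weight 0 of f and of weight d of g is the part of weight d of f g. *)
Lemma thick_primary F l f g :
  ~ thick F 1 f -> thick F l (f * g) -> thick F l g.
Proof.
move=> nf Hfg; apply: contrapT => ng.
have [m0 m0g wm0] : exists2 m, m \in msupp g & (wt F m < l)%N.
  apply: contrapT => H; apply: ng => m mg; rewrite leqNgt; apply/negP => lm.
  by apply: H; exists m.
have ex : exists d, has (fun m => wt F m == d) (msupp g).
  by exists (wt F m0); apply/hasP; exists m0.
case: (ex_minnP ex) => d /hasP[m1 m1g /eqP wm1] dmin.
have gd : thick F d g by move=> m mg; apply: dmin; apply/hasP; exists m.
have dl : (d < l)%N by apply: leq_ltn_trans wm0; apply: dmin; apply/hasP; exists m0.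
set f0 := part (fun m => wt F m == 0%N) f.
set gg := part (fun m => wt F m == d) g.
have f0n : f0 != 0.
  apply/eqP => f0E; apply: nf; apply/thickP => m.
  rewrite ltnS leqn0 => wm; have := congr1 (mcoeff m) f0E.
  by rewrite mcoeff_part wm mcoeff0.
have ggn : gg != 0.
  apply/eqP => E; have := congr1 (mcoeff m1) E.
  rewrite mcoeff_part wm1 eqxx mcoeff0 => E'.
  by move: m1g; rewrite mcoeff_msupp E' eqxx.
have H1 : thick F 1 (f - f0).
  apply/thickP => m; rewrite ltnS leqn0 => wm.
  by rewrite mcoeffB mcoeff_part wm subrr.
have H2 : thick F d.+1 (g - gg).
  apply/thickP => m; rewrite ltnS leq_eqVlt => /orP[wm|wm].
    by rewrite mcoeffB mcoeff_part wm subrr.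
  rewrite mcoeffB mcoeff_part (ltn_eqF wm) subr0.
  by move/thickP: gd; apply.
have H3 : thick F d.+1 (f0 * gg).
  have iT := thick_ideal F d.+1.
  have -> : f0 * gg = f * g - (f - f0) * g - f0 * (g - gg).
    by ring.
  apply: (idealB iT); last by case: iT => _ _; apply.
  apply: (idealB iT); first exact: thick_le dl Hfg.
  exact: (thickM H1 gd).
have : f0 * gg != 0 by rewrite mulf_neq0.
rewrite -msupp_eq0; case E : (msupp (f0 * gg)) => [//|m s] _.
have ms : m \in msupp (f0 * gg) by rewrite E inE eqxx.
have := H3 m ms.
have /allpairsP[[a b] /= [ha hb ->]] := msuppM_le ms.
rewrite wtD.
move: ha; rewrite mcoeff_msupp mcoeff_part; case: ifP => [/eqP-> _|_]; last by rewrite eqxx.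
move: hb; rewrite mcoeff_msupp mcoeff_part; case: ifP => [/eqP-> _|_]; last by rewrite eqxx.
by rewrite add0n ltnn.
Qed.

Lemma thick1_1 F : ~ thick F 1 1.
Proof. by move=> /(_ 0%MM); rewrite wt0 msupp1 inE eqxx => /(_ isT). Qed.

Lemma thick_prime F : prime_ideal (thick F 1).
Proof.
apply: prime_idealP; [exact: thick_ideal|exact: thick1_1|] => p q Hpq.
by case: (pselect (thick F 1 p)) => [|/thick_primary/(_ Hpq)]; [left|right].
Qed.

(** Weights add under multiplication, which gives one inclusion. For the other, a variable outside
    [F] can be split off [l] times from a monomial of weight at least [l]. *)
Lemma thick_pow F l : ideal_pow (thick F 1) l = thick F l.
Proof.
apply/seteqP; split.
  apply: ideal_gen_min; first exact: thick_ideal.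
  move=> _ [g /= Hg <-]; elim: l g Hg => [|l IH] g Hg; first exact: thick0.
  by rewrite big_ord_recl; apply: (@thickM _ 1) => //; apply: IH.
move=> p Hp; rewrite [p]mpolyE big_seq; apply: ideal_sum.
  exact: ideal_gen_ideal.
move=> m /Hp lm; rewrite -mul_mpolyC.
apply: (idealMl _ (ideal_gen_ideal _)); elim: l m lm {p Hp} => [|l IH] m lm; first exact: ideal_pow0.
have [i iF mi] : exists2 i, i \notin F & m i != 0%N.
  apply: contrapT => H; move: lm; rewrite /wt big1 // => i; rewrite inE => iF.
  by apply/eqP; apply: contrapT => /negP ?; apply: H; exists i.
have E : m = (U_(i) + (m - U_(i)))%MM by rewrite addmC submK // lep1mP.
rewrite E mpolyXD; apply: ideal_powS; first by apply/thickX; rewrite wtU iF.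
by apply: IH; move: lm; rewrite {1}E wtD wtU iF.
Qed.


Definition expo F : 'X_{1..n} := [multinom (i \in F : nat) | i < n].

Lemma expoE F i : expo F i = (i \in F).
Proof. exact: mnmE. Qed.

Lemma var_prodE F : var_prod k F = 'X_[expo F].
Proof.
rewrite /var_prod mpolyXE_id [RHS](bigID (mem F)) /= [X in _ * X]big1 ?mulr1.
  by apply: eq_bigr => i iF; rewrite expoE iF expr1.
by move=> i /negPf iF; rewrite expoE iF expr0.
Qed.

Lemma var_prodXE F t : var_prod k F ^+ t = 'X_[expo F *+ t].
Proof. by rewrite var_prodE mpolyXn. Qed.

Lemma wt_expo F G : wt F (expo G) = #|G :\: F|.
Proof.
rewrite /wt -sum1_card big_mkcond [RHS]big_mkcond; apply: eq_bigr => i _.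
by rewrite expoE !inE; case: (i \in F); case: (i \in G).
Qed.

End Thick.

(** * Stanley-Reisner ideals, their associated primes and symbolic powers *)

Section Complexes.
Variables (k : fieldType) (n : nat) (D : {set {set 'I_n}}).
Local Notation S := {mpoly k[n]}.
Implicit Types (F G : {set 'I_n}) (m : 'X_{1..n}) (p q f g : S).
Hypothesis hD : simplicial_complex D.

(* The l-th symbolic power of the Stanley-Reisner ideal of D. *)
Definition fat (l : nat) : set S := [set p | forall F, facet D F -> thick F l p].

Lemma fat_ideal l : ideal (fat l).
Proof.
split=> [F _|p q Hp Hq F fF|a p Hp F fF]; have [T0 TD TM] := thick_ideal k F l.
- exact: T0.
- by apply: TD; [apply: Hp|apply: Hq].
- by apply: TM; apply: Hp.
Qed.

Lemma fatX l m : fat l 'X_[m] <-> (forall F, facet D F -> (l <= wt F m)%N).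
Proof. by split=> H F /H /thickX. Qed.

Lemma face_facet F : F \in D -> exists2 G, facet D G & F \subset G.
Proof.
move=> FD.
have [G /maxsetP[GD Gmax] FG] := @maxset_exists _ (fun A => A \in D) F FD.
by exists G => //; split=> // H HD GH; apply: Gmax.
Qed.

Definition supp m : {set 'I_n} := [set i | m i != 0%N].

Lemma wt_supp F m : (0 < wt F m)%N = ~~ (supp m \subset F).
Proof.
rewrite lt0n sum_nat_eq0; congr (~~ _).
apply/forall_inP/fintype.subsetP => H i; rewrite !inE.
  by apply: contraR => iF; apply: H; rewrite inE.
by move=> iF; apply: contraR iF => mi; apply: H; rewrite inE.
Qed.

(** A monomial in all facet primes has a support contained in no facet, hence a non-face, and it is
    divisible by the squarefree monomial of that support. *)
Lemma stanley_reisnerE : stanley_reisner k D = fat 1.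
Proof.
apply/seteqP; split.
  apply: ideal_gen_min; first exact: fat_ideal.
  move=> _ [F /= FD <-]; rewrite var_prodE; apply/fatX => G [GD _].
  rewrite wt_expo card_gt0 finset.setD_eq0; apply: contra FD => FG.
  by case: hD => _; apply; [apply: GD|].
move=> p Hp; rewrite [p]mpolyE big_seq; apply: ideal_sum.
  exact: ideal_gen_ideal.
move=> m mp; rewrite -mul_mpolyC.
have [_ _ IM] := ideal_gen_ideal [set var_prod k F | F in [set F | F \notin D]].
apply: (IM).
have sD : supp m \notin D.
  apply/negP => /face_facet[G fG mG].
  by have := Hp G fG m mp; rewrite wt_supp mG.
have -> : m = (m - expo (supp m) + expo (supp m))%MM.
  rewrite submK //; apply/mnm_lepP => i; rewrite expoE inE.
  by case: (m i).
rewrite mpolyXD; apply: IM; apply: sub_ideal_gen; exists (supp m) => //.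
exact: var_prodE.
Qed.

(** Suppose that P, the annihilator of f modulo [fat 1], is no facet prime. A facet prime missing f
    contains P, hence properly, and provides a factor outside P; the product of these factors
    carries f into every facet prime, so it lies in P, against primeness. Conversely, the prime of F
    is the annihilator of x_F, which lies in the primes of all other facets but not in that of F. *)
Lemma Ass_fat : Ass (fat 1) = [set thick F 1 | F in facet D].
Proof.
apply/seteqP; split=> [P [primeP [f PE]]|_ [F fF <-]].
  apply: contrapT => H.
  have iP := prime_ideal_ideal primeP.
  have step F : exists g, ~ P g /\ (facet D F -> ~ thick F 1 f -> thick F 1 g).
    case: (pselect (facet D F /\ ~ thick F 1 f)) => [[fF nf]|nF]; last first.
      by exists 1; split; [exact: prime_ideal1|move=> fF nf; case: nF].
    have [g Hg nPg] : exists2 g, thick F 1 g & ~ P g.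
      apply: contrapT => H'; apply: H; exists F => //; apply/seteqP; split=> g Hg.
        by apply: contrapT => nPg; apply: H'; exists g.
      have : fat 1 (g * f) by move: Hg; rewrite PE.
      by move=> /(_ F fF); rewrite mulrC => /(thick_primary nf).
    by exists g.
  have [g Hg] := choice step.
  have : P (\prod_F g F).
    rewrite PE => F fF; case: (pselect (thick F 1 f)) => [tf|nf].
      by apply: (idealMl _ (thick_ideal k F 1)).
    rewrite mulrC (bigD1 F) //= mulrCA; apply: (idealMr _ (thick_ideal k F 1)).
    by case: (Hg F) => _; apply.
  apply: (@big_ind _ (fun x => ~ P x)) => [|p q np nq /(prime_idealM primeP)[]|F _] //.
    exact: prime_ideal1.
  by case: (Hg F).
split; first exact: thick_prime.
exists 'X_[expo F]; apply/seteqP; split=> g Hg.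
  move=> G fG; case: (eqVneq G F) => [->|GF].
    by apply: (idealMr _ (thick_ideal k F 1)).
  apply: (idealMl _ (thick_ideal k G 1)); apply/thickX.
  rewrite wt_expo card_gt0 finset.setD_eq0; apply: contra GF => FG.
  by case: fF fG => _ Fmax [GD _]; apply/eqP/Fmax.
move: (Hg F fF); rewrite mulrC; apply: thick_primary.
by move=> /thickX; rewrite wt_expo finset.setDv cards0.
Qed.

Lemma symbolic_power_fat l : symbolic_power (stanley_reisner k D) l = fat l.
Proof.
rewrite stanley_reisnerE /symbolic_power Ass_fat; apply/seteqP; split=> p Hp.
  by move=> F fF; rewrite -thick_pow; apply: Hp; exists F.
by move=> _ [F fF <-]; rewrite thick_pow; apply: Hp.
Qed.

End Complexes.

(** * Disconnected degree complexes *)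

Section Disconnected.
Variables (n : nat) (D : {set {set 'I_n}}).
Implicit Types (C F G H : {set 'I_n}) (b m : 'X_{1..n}).

(* The facets F with wt F b < l are the facets of Takayama's degree complex of
   the l-th symbolic power in degree b; it is split here into the faces inside
   C and the faces outside C. *)
Definition disconnected (l : nat) : Prop :=
  exists b C F1 F2,
    [/\ facet D F1, facet D F2, (wt F1 b < l)%N & (wt F2 b < l)%N] /\
    [/\ F1 \subset C, F2 \subset ~: C
      & forall F, facet D F -> (wt F b < l)%N -> F \subset C \/ F \subset ~: C].

Hypothesis hD : simplicial_complex D.
Hypothesis hdim : complex_dim D = 1%R.

Lemma max_card_face : (\max_(F in D) #|F| = 2)%N.
Proof. by move: hdim; rewrite /complex_dim; set M := (\max_(_ in _) _)%N; lia. Qed.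

Lemma card_face F : F \in D -> (#|F| <= 2)%N.
Proof.
by move=> FD; rewrite -max_card_face (@leq_bigmax_cond _ _ (fun F : {set 'I_n} => #|F|)).
Qed.

Lemma exists_edge : exists2 F, F \in D & #|F| = 2%N.
Proof.
have [[F0 F0D] _] := hD.
have D0 : (0 < #|D|)%N by apply/card_gt0P; exists F0.
have [F FD E] := @eq_bigmax_cond _ (mem D) (fun F : {set 'I_n} => #|F|) D0.
by exists F => //; rewrite -E max_card_face.
Qed.

Lemma edge_facet F : F \in D -> #|F| = 2%N -> facet D F.
Proof.
move=> FD F2; split=> // G GD FG; apply/esym/eqP.
by rewrite eqEcard FG F2 card_face.
Qed.

Lemma facet_neq0 F : facet D F -> F != finset.set0.
Proof.
case=> _ Fmax; apply/eqP => F0; have [E ED E2] := exists_edge.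
by move: E2; rewrite (Fmax E ED) F0 ?cards0 ?finset.sub0set.
Qed.

(** By this identity, the two pairs of opposite sides of a 4-cycle have the same total weight. *)
Lemma wt_mdeg2 b (p r : 'I_n) : p != r ->
  (wt [set p; r] b + b p + b r = mdeg b)%N.
Proof.
move=> pr; rewrite mdegE (bigID (fun i => i \in [set p; r]%SET)) /=.
rewrite -addnA addnC /wt; congr (_ + _)%N.
  by rewrite big_setU1 ?big_set1 ?inE.
by apply: eq_bigl => i; rewrite !inE.
Qed.

Lemma disconnected_isolated F l :
  facet D F -> #|F| = 1%N -> (0 < l)%N -> disconnected l.
Proof.
move=> fF /eqP/cards1P[v FE] l0; have [E ED E2] := exists_edge.
have Fdich G : facet D G -> G \subset F \/ G \subset ~: F.
  case=> GD _; case: (boolP (v \in G)) => vG; [left|right].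
    by case: fF => _ Fmax; rewrite (Fmax G GD) // FE finset.sub1set.
  by rewrite FE finset.subsetC finset.sub1set inE.
(* At the exponent 0 every facet has weight 0, so that all of [D] is seen. *)
exists 0%MM, F, F, E; rewrite !wt0; split; split=> //.
- exact: edge_facet.
- case: (Fdich E (edge_facet ED E2)) => // /subset_leq_card.
  by rewrite E2 FE cards1.
- by move=> G fG _; apply: Fdich.
Qed.

Hypothesis pureD : forall F, facet D F -> #|F| = 2%N.

(** At the exponent l v + G a facet F has weight |G \ F|, plus l if v is not in F. Facets through v
    have weight at most 2, which is less than l + 1; a facet avoiding v has weight at most l only if
    it contains, hence equals, G. Those through v are disjoint from G by non-adjacency. *)
Lemma disconnected_nonadjacent l v G :
  (1 < l)%N -> [set v]%SET \in D -> facet D G -> v \notin G ->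
  (forall g, g \in G -> [set v; g]%SET \notin D) -> disconnected l.+1.
Proof.
move=> l1 vD fG vG nadj.
have [H fH] := face_facet vD; rewrite finset.sub1set => vH.
have vfar F : facet D F -> v \in F -> F \subset ~: G.
  move=> [FD _] vF; apply/fintype.subsetP => g gF; rewrite inE.
  apply: contraL FD => gG; apply: contra (nadj g gG) => FD.
  by case: hD => _; apply; [exact: FD|rewrite finset.subUset !finset.sub1set vF].
exists (U_(v) *+ l + expo G)%MM, (~: G), H, G.
rewrite !wtD !wtMn !wtU !wt_expo vH (negPf vG) finset.setDv cards0; split; split=> //.
- rewrite mul0n add0n; apply: leq_ltn_trans (subset_leq_card (finset.subsetDl _ _)) _.
  by rewrite pureD // ltnS ltnW.
- by rewrite mul1n addn0.
- exact: vfar.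
- by rewrite finset.setCK.
- move=> F fF; rewrite !wtD !wtMn !wtU !wt_expo; case: (boolP (v \in F)) => vF.
    by left; apply: vfar.
  rewrite mul1n ltnS -[X in (_ <= X)%N]addn0 leq_add2l leqn0 cards_eq0 finset.setD_eq0 => GF; right.
  by case: fF fG => FD _ [_ /(_ F FD GF) ->]; rewrite finset.setCK.
Qed.

Lemma disconnectedS l : (0 < l)%N -> disconnected l -> disconnected l.+1.
Proof.
move=> l0 [b [C [F1 [F2 [[fF1 fF2 w1 w2] [F1C F2C Cdich]]]]]].
have F12 i : i \in F1 -> i \notin F2.
  by move=> /(fintype.subsetP F1C) iC; apply: contraTN iC => /(fintype.subsetP F2C); rewrite inE.
case: (ltnP 1 l) => [l1|]; last first.
  move=> l1; have {l0 l1} lE : l = 1%N by apply/eqP; rewrite eqn_leq l1.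
  (* Each variable lies outside [F1] or outside [F2], and both have weight 0. *)
  subst l; have b0 : b = 0%MM.
    apply/mnmP => i; rewrite mnm0E; apply/eqP.
    have [F wF iF] : exists2 F, wt F b = 0%N & i \notin F.
      by case: (boolP (i \in F1)) => [/F12|]; [exists F2|exists F1] => //; lia.
    by move/eqP: wF; rewrite sum_nat_eq0 => /forall_inP; apply; rewrite inE.
  have [i iF1] := finset.set0Pn _ (facet_neq0 fF1).
  have [j jF2] := finset.set0Pn _ (facet_neq0 fF2).
  (* As [b] is 0, [Cdich] already covers all facets of [D]; only the weights of [F1] and [F2], at
     most 1 each, have to be checked. *)
  exists (U_(i) + U_(j))%MM, C, F1, F2; rewrite !wtD !wtU iF1 jF2; split; split=> //.
  - by case: (_ \in _).
  - by case: (_ \in _).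
  - by move=> F fF _; apply: Cdich; rewrite ?b0 ?wt0.
apply: contrapT => ndisc.
have adj v G : facet D G -> [set v]%SET \in D -> v \notin G ->
    exists2 g, g \in G & [set v; g]%SET \in D.
  move=> fG vD vG; apply: contrapT => nadj; apply: ndisc.
  apply: (@disconnected_nonadjacent l v G) => // g gG; apply/negP => vgD.
  by apply: nadj; exists g.
have vtx F v : facet D F -> v \in F -> [set v]%SET \in D.
  by case=> FD _ vF; case: hD => _; apply; [exact: FD|rewrite finset.sub1set].
(* Together, pr and qs weigh as much as [F1] and [F2], so one of them has weight less than [l]; but
   both edges cross the boundary of [C]. *)
have match_absurd p q r s : F1 = [set p; q]%SET -> F2 = [set r; s]%SET -> p != q -> r != s ->
    [set p; r]%SET \in D -> [set q; s]%SET \in D -> False.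
  move=> E1 E2 pq rs prD qsD.
  have [pF1 qF1] : p \in F1 /\ q \in F1 by rewrite E1 !inE !eqxx orbT.
  have [rF2 sF2] : r \in F2 /\ s \in F2 by rewrite E2 !inE !eqxx orbT.
  have cross x y : x \in F1 -> y \in F2 -> x != y.
    by move=> xF1 yF2; apply: contraTneq yF2 => <-; apply: F12.
  have nsep x y : x \in F1 -> y \in F2 -> [set x; y]%SET \in D -> (wt [set x; y] b < l)%N -> False.
    move=> xF1 yF2 xyD /(Cdich _ (edge_facet xyD _)); rewrite cards2 cross //.
    have xC := fintype.subsetP F1C x xF1; have := fintype.subsetP F2C y yF2.
    rewrite inE => /negPf yC.
    case=> // [/fintype.subsetP/(_ y)|]; first by rewrite !inE eqxx orbT yC => /(_ isT).
    by move=> /fintype.subsetP/(_ x); rewrite !inE eqxx xC => /(_ isT).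
  have := wt_mdeg2 b pq; have := wt_mdeg2 b rs.
  have := wt_mdeg2 b (cross p r pF1 rF2); have := wt_mdeg2 b (cross q s qF1 sF2).
  rewrite -E1 -E2 => e1 e2 e3 e4.
  case: (ltnP (wt [set p; r] b) l) => [|h1]; first exact: nsep.
  case: (ltnP (wt [set q; s] b) l) => [|h2]; first exact: nsep.
  move: e1 e2 e3 e4 h1 h2 w1 w2.
  move: (wt _ _) (wt _ _) (wt _ _) (wt _ _) (mdeg b) (b p) (b q) (b r) (b s).
  clear; lia.
have /eqP/cards2P[p [q [pq E1]]] := pureD fF1.
have /eqP/cards2P[r [s [rs E2]]] := pureD fF2.
have adj1 x : x \in F1 -> [set x; r]%SET \in D \/ [set x; s]%SET \in D.
  move=> xF1; have [g] := adj x F2 fF2 (vtx F1 x fF1 xF1) (F12 x xF1).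
  by rewrite E2 !inE => /orP[] /eqP ->; [left|right].
have adj2 x : x \in F2 -> [set p; x]%SET \in D \/ [set q; x]%SET \in D.
  move=> xF2; have xF1 : x \notin F1 by apply: contraL xF2 => /F12.
  have [g] := adj x F1 fF1 (vtx F2 x fF2 xF2) xF1.
  by rewrite E1 !inE finset.setUC => /orP[] /eqP ->; [left|right].
(* A bipartite graph between {p, q} and {r, s} without isolated vertices contains a perfect
   matching, and both possible matchings are now excluded. *)
have := match_absurd p q r s E1 E2 pq rs.
have := match_absurd p q s r E1 (etrans E2 (finset.setUC _ _)) pq.
rewrite eq_sym => /(_ rs) m1 m2.
have p1 := adj1 p; have q1 := adj1 q; have r1 := adj2 r; have s1 := adj2 s.
move: p1 q1 r1 s1; rewrite E1 E2 !inE !eqxx !orbT.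
move=> /(_ isT) p1 /(_ isT) q1 /(_ isT) r1 /(_ isT) s1.
tauto.
Qed.

End Disconnected.

(** * Gluing fractions along a connected degree complex *)

Section Gluing.
Variables (k : fieldType) (n : nat) (D : {set {set 'I_n}}) (l : nat).
Local Notation S := {mpoly k[n]}.
Implicit Types (F G : {set 'I_n}) (b m : 'X_{1..n}).

Lemma mcoeffMX_eq0 (p : S) m m0 : ~~ (m0 <= m)%MM -> (p * 'X_[m0])@_m = 0.
Proof.
move=> H; apply: memN_msupp_eq0; rewrite (perm_mem (msuppMX p m0)).
by apply: contra H => /mapP[m' _ ->]; apply: lem_addr.
Qed.

Lemma mcoeffMXr (p : S) m m0 : (p * 'X_[m0])@_(m + m0) = p@_m.
Proof. by rewrite addmC mcoeffMX. Qed.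

Lemma leUn (i : 'I_n) t m : (U_(i) *+ t <= m)%MM = (t <= m i)%N.
Proof.
apply/mnm_lepP/idP => [/(_ i)|tm j]; rewrite mulmnE mnm1E ?eqxx ?mul1n //.
by case: eqP => [<-|]; rewrite ?mul1n // mul0n.
Qed.

Lemma wt_addUn F i t b : i \in F -> wt F (b + U_(i) *+ t)%MM = wt F b.
Proof. by move=> iF; rewrite wtD wtMn wtU iF addn0. Qed.

Hypothesis pureD : forall F, facet D F -> #|F| = 2%N.
Hypothesis conn : ~ disconnected D l.

(** Coefficientwise, the fractions p_i / x_i^t define at each exponent b a function on the vertices
    that is constant on every facet of weight less than [l]. Connectedness makes it constant on all
    these facets together, and its value is the coefficient of c at b. *)
Lemma glue (t : nat) (p : 'I_n -> S) :
  (forall F i j, facet D F -> i \in F -> j \in F ->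
     thick F l (p j * 'X_i ^+ t - p i * 'X_j ^+ t)) ->
  exists c, forall F i, facet D F -> i \in F -> thick F l (p i - c * 'X_i ^+ t).
Proof.
move=> Hp.
have val_const b : exists x, forall F i, facet D F -> (wt F b < l)%N -> i \in F ->
    (p i)@_(b + U_(i) *+ t) = x.
  have edge_eq F i j : facet D F -> (wt F b < l)%N -> i \in F -> j \in F ->
      (p i)@_(b + U_(i) *+ t) = (p j)@_(b + U_(j) *+ t).
    move=> fF wF iF jF; have /thickP := Hp F i j fF iF jF.
    move=> /(_ (b + U_(i) *+ t + U_(j) *+ t)%MM); rewrite !wt_addUn // => /(_ wF).
    rewrite mcoeffB !mpolyXn mcoeffMXr -addmA (addmC (U_(i) *+ t)%MM) addmA.
    by rewrite mcoeffMXr => /eqP; rewrite subr_eq0 eq_sym => /eqP.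
  case: (pselect (exists F i, [/\ facet D F, (wt F b < l)%N & i \in F])); last first.
    by move=> H; exists 0 => F i fF wF iF; case: H; exists F, i.
  move=> [F1 [i1 [fF1 wF1 iF1]]]; exists (p i1)@_(b + U_(i1) *+ t) => F i fF wF iF.
  apply: contrapT => neq; apply: conn.
  (* If two values occurred, the level set of one of them would split the facets. *)
  exists b, [set j | (p j)@_(b + U_(j) *+ t) == (p i1)@_(b + U_(i1) *+ t)]%SET, F1, F.
  split; split=> //.
  - by apply/fintype.subsetP => j jF1; rewrite inE; apply/eqP; apply: (edge_eq F1).
  - apply/fintype.subsetP => j jF; rewrite !inE; apply/eqP => jE; apply: neq.
    by rewrite -jE; apply: (edge_eq F).
  - move=> G fG wG.
    have [j jG] : exists j, j \in G by apply/card_gt0P; rewrite pureD.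
    case: (eqVneq ((p j)@_(b + U_(j) *+ t)) ((p i1)@_(b + U_(i1) *+ t))) => jE; [left|right];
      apply/fintype.subsetP => j' j'G; rewrite !inE (edge_eq G _ j) //.
    by rewrite jE.
have [val Hval] := choice val_const.
(* From degree K on, the relevant coefficients of all [p i] vanish, so truncating there loses
   nothing and makes c a polynomial. *)
pose K := (\max_i msize (p i))%N.
pose c := \sum_(b : 'X_{1..n < K}) val b *: 'X_[b].
have cE b F i : facet D F -> (wt F b < l)%N -> i \in F ->
    c@_b = (p i)@_(b + U_(i) *+ t).
  move=> fF wF iF; rewrite (Hval b F i) //.
  case: (ltnP (mdeg b) K) => bK; first exact: mcoeff_mpoly.
  rewrite -(Hval b F i) // /c raddf_sum /= big1 => [|b' _].
    apply/esym/memN_msupp_eq0/msize_mdeg_ge.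
    apply: leq_trans (leq_bigmax (F := fun i => msize (p i)) i) _.
    by apply: leq_trans bK _; rewrite mdegD leq_addr.
  rewrite mcoeffZ mcoeffX; case: eqP => [E'|_]; last by rewrite mulr0.
  by move: (bmdeg b'); rewrite E' ltnNge bK.
exists c => F i fF iF; apply/thickP => m wm; rewrite mcoeffB mpolyXn.
case: (boolP (U_(i) *+ t <= m)%MM) => im.
  move: wm; rewrite -(submK im); set b := (m - _)%MM.
  by rewrite wt_addUn // => wb; rewrite mcoeffMXr (cE b F i) // subrr.
rewrite (mcoeffMX_eq0 _ im) subr0.
(* Here x_i^t does not divide x^m, so the coefficient of [p i] at m must vanish. The other vertex j
   shows it: this coefficient equals one of p_j x_i^t at an exponent still not divisible by
   x_i^t. *)
have [j jF ji] : exists2 j, j \in F & j != i.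
  have /card_gt0P[j] : (0 < #|(F :\ i)%SET|)%N.
    by have := pureD fF; rewrite (cardsD1 i) iF; case: #|_|.
  by rewrite !inE => /andP[? ?]; exists j.
have /thickP := Hp F i j fF iF jF.
move=> /(_ (m + U_(j) *+ t)%MM); rewrite wt_addUn // => /(_ wm).
rewrite mcoeffB !mpolyXn mcoeffMXr mcoeffMX_eq0 ?sub0r => [/eqP|].
  by rewrite oppr_eq0 => /eqP.
by move: im; rewrite !leUn mnmDE mulmnE mnm1E (negPf ji) mul0n addn0.
Qed.

End Gluing.

(** * The Cech complex *)

Section Localization.
Variables (k : fieldType) (n : nat).
Local Notation S := {mpoly k[n]}.
Local Notation Q := {fraction S}.
Implicit Types (I J : set S) (F G : {set 'I_n}) (p f g : S) (q : Q).

Local Notation xF F := (tofrac (var_prod k F)).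

Lemma var_prod_neq0 F : var_prod k F != 0.
Proof.
by rewrite var_prodE; apply/eqP => /(congr1 (mcoeff (expo F)))/eqP;
  rewrite mcoeffX eqxx mcoeff0 oner_eq0.
Qed.

Lemma xF_neq0 F t : xF F ^+ t != 0.
Proof. by rewrite expf_neq0 // tofrac_eq0 var_prod_neq0. Qed.

Lemma idealT : ideal [set: S].
Proof. by []. Qed.

Lemma loc_tofrac I F p : I p -> loc I F (tofrac p).
Proof. by move=> Ip; exists p, 0%N; rewrite expr0 divr1. Qed.

Lemma loc0 I F : ideal I -> loc I F 0.
Proof. by case=> I0 _ _; rewrite -(rmorph0 (@tofrac S)); apply: loc_tofrac. Qed.

Lemma locM I F a q : ideal I -> loc setT F a -> loc I F q -> loc I F (a * q).
Proof.
move=> iI [p1 [t1 [_ ->]]] [p2 [t2 [Ip2 ->]]]; exists (p1 * p2), (t1 + t2)%N.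
split; first exact: idealMl.
by rewrite rmorphM exprD mulf_div.
Qed.

Lemma locD I F q1 q2 : ideal I -> loc I F q1 -> loc I F q2 -> loc I F (q1 + q2).
Proof.
move=> iI [p1 [t1 [Ip1 ->]]] [p2 [t2 [Ip2 ->]]].
exists (p1 * var_prod k F ^+ t2 + p2 * var_prod k F ^+ t1), (t1 + t2)%N.
split; first by case: (iI) => _ ID _; apply: ID; apply: idealMr.
by rewrite addf_div ?xF_neq0 // rmorphD !rmorphM !rmorphXn exprD.
Qed.

Lemma locN I F q : ideal I -> loc I F q -> loc I F (- q).
Proof.
move=> iI [p [t [Ip ->]]]; exists (- p), t; split; first exact: idealN.
by rewrite rmorphN mulNr.
Qed.

Lemma locB I F q1 q2 : ideal I -> loc I F q1 -> loc I F q2 -> loc I F (q1 - q2).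
Proof. by move=> iI H1 H2; apply: locD => //; apply: locN. Qed.

Lemma loc_sum I F (T : Type) (r : seq T) (P : pred T) (h : T -> Q) :
  ideal I -> (forall i, P i -> loc I F (h i)) -> loc I F (\sum_(i <- r | P i) h i).
Proof.
move=> iI H; elim/big_ind: _ => //; first exact: loc0.
by move=> *; apply: locD.
Qed.

Lemma loc_subI I J F q : I `<=` J -> loc I F q -> loc J F q.
Proof. by move=> IJ [p [t [/IJ Jp ->]]]; exists p, t. Qed.

Lemma var_prodID F G : F \subset G ->
  var_prod k G = var_prod k F * var_prod k (G :\: F)%SET.
Proof.
move=> FG; rewrite !var_prodE -mpolyXD; congr mpolyX; apply/mnmP => i.
rewrite mnmDE !expoE !inE; case: (boolP (i \in F)) => //= iF.
by rewrite (fintype.subsetP FG).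
Qed.

Lemma loc_subset I F G q : ideal I -> F \subset G -> loc I F q -> loc I G q.
Proof.
move=> iI FG [p [t [Ip ->]]]; exists (p * var_prod k (G :\: F)%SET ^+ t), t.
split; first exact: idealMr.
rewrite (var_prodID FG) !rmorphM rmorphXn exprMn -mulf_div divff ?mulr1 //.
exact: xF_neq0.
Qed.

Lemma loc_sign F e : loc [set: S] F ((-1) ^+ e).
Proof.
have -> : (-1) ^+ e = tofrac ((-1) ^+ e : S) by rewrite rmorphXn rmorphN1.
exact: loc_tofrac.
Qed.

Lemma loc_cech_diff I (u : cech_cochain k n) G : ideal I ->
  (forall F, loc I F (u F)) -> loc I G (cech_diff u G).
Proof.
move=> iI Hu; rewrite ffunE; apply: loc_sum => // i iG.
apply: locM => //; first exact: loc_sign.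
exact: (loc_subset iI (finset.subsetDl _ _)).
Qed.

Lemma cech_diffD (u v : cech_cochain k n) : cech_diff (u + v) = cech_diff u + cech_diff v.
Proof.
apply/ffunP => G; rewrite !ffunE -big_split; apply: eq_bigr => i _.
by rewrite ffunE mulrDr.
Qed.

Lemma cech_diffZ f (u : cech_cochain k n) : cech_diff (cech_scale f u) = cech_scale f (cech_diff u).
Proof.
apply/ffunP => G; rewrite !ffunE mulr_sumr; apply: eq_bigr => i _.
by rewrite ffunE mulrCA.
Qed.

Lemma eq_cech_diff (u v : cech_cochain k n) G :
  (forall F, #|F|.+1 = #|G| -> u F = v F) -> cech_diff u G = cech_diff v G.
Proof.
move=> uv; rewrite !ffunE; apply: eq_bigr => i iG; rewrite uv //.
by rewrite (cardsD1 i G) iG.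
Qed.

Local Notation sg G i := ((-1) ^+ #|[pred h in (G : {set 'I_n}) | (h < i)%N]| : Q).

Lemma sgD1 G i j : j \in G -> sg G i = (-1) ^+ (j < i)%N * sg (G :\ j)%SET i.
Proof.
move=> jG; rewrite -exprD (cardD1 j) !inE jG /=; congr (_ ^+ (_ + _)).
by apply: eq_card => h; rewrite !inE andbA.
Qed.

(** In characteristic 2 a sum equal to its own negative need not vanish; therefore the terms with j
    < i are cancelled against those with i < j. *)
Lemma sum_antisym (T : 'I_n -> 'I_n -> Q) :
  (forall i j, T j i = - T i j) -> (forall i, T i i = 0) -> \sum_i \sum_j T i j = 0.
Proof.
move=> Ta T0.
have -> : \sum_i \sum_j T i j =
    \sum_(i < n) \sum_(j < n | (j < i)%N) T i j + \sum_(i < n) \sum_(j < n | (i < j)%N) T i j.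
  rewrite -big_split; apply: eq_bigr => i _ /=.
  rewrite (bigID (fun j : 'I_n => (j < i)%N)) /=; congr (_ + _).
  rewrite (bigD1 i) ?ltnn //= T0 add0r; apply: eq_bigl => j.
  by rewrite -leqNgt ltn_neqAle andbC eq_sym.
rewrite [X in _ + X](exchange_big_dep predT) //= -big_split big1 // => i _ /=.
rewrite [X in X + _](eq_bigr (fun j => - T j i)) => [|j _]; last exact: Ta.
by rewrite sumrN addNr.
Qed.

Lemma cech_diffK (u : cech_cochain k n) : cech_diff (cech_diff u) = 0.
Proof.
apply/ffunP => G; rewrite !ffunE.
pose T i j := if [&& i \in G, j \in G & j != i]
  then sg G i * (sg (G :\ i)%SET j * u (G :\ i :\ j)%SET) else 0.
rewrite big_mkcond -[RHS](@sum_antisym T) => [|i j|i]; last first.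
- by rewrite /T eqxx !andbF.
- rewrite /T [j == i]eq_sym; case: (boolP (i \in G)) => iG; last by rewrite andbF oppr0.
  case: (boolP (j \in G)) => jG /=; last by rewrite oppr0.
  case: (eqVneq i j) => [_|ij]; first by rewrite oppr0.
  rewrite (sgD1 j iG) (sgD1 i jG).
  have -> : (G :\ j :\ i = G :\ i :\ j)%SET by rewrite finset.setDDl finset.setUC -finset.setDDl.
  set a := sg (G :\ i)%SET j; set b := sg (G :\ j)%SET i; set w := u _.
  case: (ltngtP i j) => [_|_|/val_inj E]; last by rewrite E eqxx in ij.
    by rewrite /= mul1r mulN1r mulNr mulrCA.
  by rewrite /= mul1r mulN1r mulNr opprK mulrCA.
apply: eq_bigr => i _; rewrite /T; case: ifP => iG; last by rewrite big1.
rewrite ffunE mulr_sumr [LHS]big_mkcond; apply: eq_bigr => j _.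
by rewrite !inE andbC; case: ifP.
Qed.

End Localization.

(** * Vanishing of Cech cohomology below the length of a regular sequence *)

Section RegularSequences.
Variables (k : fieldType) (n : nat).
Local Notation S := {mpoly k[n]}.
Local Notation Q := {fraction S}.
Local Notation cochain := (cech_cochain k n).
Implicit Types (I J : set S) (F G : {set 'I_n}) (p f g : S) (q : Q) (u v : cochain).
Local Notation sg G i := ((-1) ^+ #|[pred h in (G : {set 'I_n}) | (h < i)%N]| : Q).

Lemma cech_scaleE f u F : cech_scale f u F = tofrac f * u F.
Proof. by rewrite ffunE. Qed.

Lemma cochainDE u v F : (u + v) F = u F + v F.
Proof. by rewrite ffunE. Qed.

Lemma cech_scale1 u : cech_scale 1 u = u.
Proof. by apply/ffunP => F; rewrite ffunE rmorph1 mul1r. Qed.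

Lemma cech_scaleA f g u : cech_scale f (cech_scale g u) = cech_scale (f * g) u.
Proof. by apply/ffunP => F; rewrite !ffunE rmorphM mulrA. Qed.

Lemma cech_scaleD f g u : cech_scale (f + g) u = cech_scale f u + cech_scale g u.
Proof. by apply/ffunP => F; rewrite !ffunE rmorphD mulrDl. Qed.

Lemma cech_degD j u v : cech_deg j u -> cech_deg j v -> cech_deg j (u + v).
Proof.
move=> Hu Hv F; have := Hu F; have := Hv F; rewrite ffunE.
by case: ifP => _ => [|-> ->]; [move=> h1 h2; apply: locD|rewrite addr0].
Qed.

Lemma cech_degZ j f u : cech_deg j u -> cech_deg j (cech_scale f u).
Proof.
move=> Hu F; have := Hu F; rewrite ffunE.
case: ifP => _ => [|->]; last by rewrite mulr0.
by apply: locM => //; apply: loc_tofrac.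
Qed.

Lemma cech_deg_loc j u F : cech_deg j u -> loc setT F (u F).
Proof. by move=> /(_ F); case: ifP => // _ ->; apply: loc0. Qed.

Lemma cech_cocycleZ I j f u : ideal I -> cech_cocycle I j u -> cech_cocycle I j (cech_scale f u).
Proof.
move=> iI [du zu]; split=> [|G Gj]; first exact: cech_degZ.
rewrite cech_diffZ cech_scaleE; apply: locM => //; first exact: loc_tofrac.
exact: zu.
Qed.

Lemma cech_coboundaryD I j u v : ideal I ->
  cech_coboundary I j u -> cech_coboundary I j v -> cech_coboundary I j (u + v).
Proof.
move=> iI [du [w [lw Hw]]] [dv [z [lz Hz]]]; split; first exact: cech_degD.
exists (w + z); split=> [F|F Fj]; first by rewrite ffunE; apply: locD.
rewrite cech_diffD !cochainDE opprD addrACA.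
by apply: locD => //; [apply: Hw|apply: Hz].
Qed.

Lemma cech_coboundaryZ I j f u : ideal I ->
  cech_coboundary I j u -> cech_coboundary I j (cech_scale f u).
Proof.
move=> iI [du [w [lw Hw]]]; split; first exact: cech_degZ.
exists (cech_scale f w); split=> [F|F Fj].
  by rewrite cech_scaleE; apply: locM => //; apply: loc_tofrac.
rewrite cech_diffZ !cech_scaleE -mulrBr; apply: locM => //; last exact: Hw.
exact: loc_tofrac.
Qed.

(** It lets one exponent serve for finitely many denominators at once. *)
Lemma finite_uniform (T : finType) (P : T -> nat -> Prop) :
  (forall x, exists t, P x t) -> (forall x s t, (s <= t)%N -> P x s -> P x t) ->
  exists t, forall x, P x t.
Proof.
move=> /choice[t Ht] mono; exists (\max_x t x)%N => x.
by apply: mono (Ht x); apply: (leq_bigmax (F := t)).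
Qed.

Lemma loc_torsion I F i q : ideal I -> loc I (i |: F)%SET q ->
  exists t, loc I F (tofrac ('X_i ^+ t) * q).
Proof.
move=> iI; case: (boolP (i \in F)) => iF.
  move=> H; exists 0%N; rewrite expr0 rmorph1 mul1r.
  by rewrite (finset.setUidPr _) ?finset.sub1set in H.
move=> [p [t [Ip ->]]]; exists t, p, t; split=> //.
rewrite /var_prod big_setU1 //= !rmorphM !rmorphXn exprMn mulrCA; congr (_ * _).
rewrite invfM mulrA divff ?mul1r // expf_neq0 // tofrac_eq0.
have := @var_prod_neq0 k n [set i]%SET.
by rewrite /var_prod big_set1.
Qed.

Lemma loc_torsion_le I F i q (s t : nat) : ideal I -> (s <= t)%N ->
  loc I F (tofrac ('X_i ^+ s) * q) -> loc I F (tofrac ('X_i ^+ t) * q).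
Proof.
move=> iI st H; rewrite -(subnK st) exprD rmorphM -mulrA; apply: locM => //.
exact: loc_tofrac.
Qed.

(* Over the localization at x_i the Cech complex is contracted by
   u |-> (F |-> +- u (i |: F)); a power of x_i clears the denominators. *)
Lemma cech_torsion I j u i : ideal I -> cech_cocycle I j u ->
  exists t, cech_coboundary I j (cech_scale ('X_i ^+ t) u).
Proof.
move=> iI [du zu].
have [t Ht] : exists t, forall F : {set 'I_n},
    loc setT F (tofrac ('X_i ^+ t) * u (i |: F)%SET) /\
    (#|F| = j -> i \notin F -> loc I F (tofrac ('X_i ^+ t) * cech_diff u (i |: F)%SET)).
  apply: finite_uniform => [F|F s t st [H1 H2]]; last first.
    split; first exact: loc_torsion_le st H1.
    by move=> Fj iF; apply: loc_torsion_le st (H2 Fj iF).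
  have [t1 H1] := loc_torsion (@idealT _ _) (cech_deg_loc (i |: F)%SET du).
  case: (boolP ((#|F| == j) && (i \notin F))) => [/andP[/eqP Fj iF]|H].
    have Gj : #|(i |: F)%SET| = j.+1 by rewrite cardsU1 iF Fj.
    have [t2 H2] := loc_torsion iI (zu _ Gj).
    exists (t1 + t2)%N; split=> [|_ _].
      exact: (loc_torsion_le (@idealT _ _) (leq_addr _ _) H1).
    exact: (loc_torsion_le iI (leq_addl _ _) H2).
  by exists t1; split=> // Fj iF; move: H; rewrite Fj eqxx iF.
set x := tofrac ('X_i ^+ t) in Ht.
exists t; split; first exact: cech_degZ.
exists [ffun F : {set 'I_n} => if i \in F then 0 else sg F i * (x * u (i |: F)%SET)].
split=> [F|F Fj].
  rewrite ffunE; case: ifP => iF; first exact: loc0.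
  by apply: locM => //; [apply: loc_sign|apply: (Ht F).1].
have sgK (e : nat) q : (-1) ^+ e * ((-1) ^+ e * q) = q.
  by rewrite mulrA -exprMn mulrNN mulr1 expr1n mul1r.
rewrite cech_scaleE -/x [cech_diff _ _]ffunE; case: (boolP (i \in F)) => iF.
  rewrite (bigD1 i) //= big1 ?addr0 => [|g /andP[gF gi]]; last first.
    by rewrite ffunE !inE iF eq_sym gi mulr0.
  rewrite ffunE !inE eqxx /= (sgD1 k i iF) ltnn expr0 mul1r sgK finset.setD1K // subrr.
  exact: loc0.
(* This is the homotopy identity x u - d (h u) = h (d u) for the contraction h; the right-hand side
   is controlled by the cocycle condition. *)
have -> : x * u F - \sum_(g in F) sg F g *
      [ffun F : {set 'I_n} => if i \in F then 0 else sg F i * (x * u (i |: F)%SET)] (F :\ g)%SET =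
    sg F i * (x * cech_diff u (i |: F)%SET); last first.
  by apply: locM => //; [apply: loc_sign|apply: (Ht F).2].
rewrite ffunE big_setU1 //= (sgD1 k i (finset.setU11 _ _)) ltnn expr0 mul1r.
rewrite finset.setU1K // mulrDr mulrDr [x * (sg F i * _)]mulrCA sgK; congr (_ + _).
rewrite -sumrN mulr_sumr mulr_sumr; apply: eq_bigr => g gF.
have gi : g != i by apply: contraNneq iF => <-.
rewrite ffunE !inE (negPf iF) andbF.
have -> : ((i |: F) :\ g = i |: (F :\ g))%SET.
  by apply/setP => h; rewrite !inE; case: (eqVneq h i) => // ->; rewrite eq_sym gi.
rewrite (sgD1 k g (finset.setU11 i F)) finset.setU1K // (sgD1 k i gF).
move: (u _) (sg F g) (sg _ i) => w a b.
case: (ltngtP g i) gi => [_|_|/val_inj ->] /=; last by rewrite eqxx.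
  by rewrite expr1 expr0 mulN1r mul1r mulNr (mulrCA x a) (mulrCA b a).
by rewrite expr1 expr0 mulN1r mul1r mulNr !mulrN (mulrCA x a) (mulrCA b a).
Qed.

(** Otherwise every monomial outside [A] could be multiplied by some variable without entering [A].
    This yields monomials outside [A] of every degree, but beyond the sum of the exponents t_i a
    monomial is divisible by some x_i^(t_i). *)
Lemma max_ideal_socle (A : set S) : ideal A -> ~ A 1 ->
  (forall i, exists t, A ('X_i ^+ t)) ->
  exists g, ~ A g /\ forall f, max_ideal f -> A (f * g).
Proof.
move=> iA A1 /choice[t At]; apply: contrapT => H.
have step m : ~ A 'X_[m] -> exists i, ~ A 'X_[m + U_(i)].
  move=> Am; apply: contrapT => Hi; apply: H; exists 'X_[m]; split=> // f.
  apply: (@ideal_gen_min _ _ [set f | A (f * 'X_[m])]) => [|_ [i _ <-]].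
    split=> [|p q Ap Aq|a p Ap] /=.
    - by rewrite mul0r; case: iA.
    - by rewrite mulrDl; case: (iA) => _ AD _; apply: AD.
    - by rewrite -mulrA; apply: idealMl.
  by rewrite /= mulrC -mpolyXD; apply: contrapT => nA; apply: Hi; exists i.
have unbounded d : exists2 m, mdeg m = d & ~ A 'X_[m].
  elim: d => [|d [m <- /step[i Ai]]]; first by exists 0%MM; rewrite ?mdeg0 ?mpolyX0.
  by exists (m + U_(i))%MM; rewrite // mdegD mdeg1 addn1.
have [m md] := unbounded (\sum_i t i).+1.
have [i ti] : exists i, (t i <= m i)%N.
  apply: contrapT => Hi; have : (mdeg m <= \sum_i t i)%N; last by rewrite md ltnn.
  rewrite mdegE; apply: leq_sum => i _; rewrite leqNgt; apply/negP => /ltnW ti.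
  by apply: Hi; exists i.
apply; rewrite -(submK (_ : (U_(i) *+ t i <= m)%MM)) ?leUn // mpolyXD.
by apply: idealMl; rewrite // -mpolyXn.
Qed.

Lemma loc_regular J f F q : (forall g, J (f * g) -> J g) -> ideal J ->
  loc setT F q -> loc J F (tofrac f * q) -> loc J F q.
Proof.
move=> reg iJ [p [t [_ ->]]] [a [s [Ja E]]].
exists (p * var_prod k F ^+ s), (t + s)%N; split.
  apply: reg; suff -> : f * (p * var_prod k F ^+ s) = a * var_prod k F ^+ t.
    exact: idealMr.
  apply/eqP; rewrite -tofrac_eq !rmorphM !rmorphXn mulrA; apply/eqP.
  move/eqP: E; rewrite mulrA eqr_div ?xF_neq0 // => /eqP ->; reflexivity.
rewrite rmorphM rmorphXn exprD -mulf_div divff ?mulr1 //; exact: xF_neq0.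
Qed.

(* The connecting step of the long exact sequence of
   0 -> S/J -> S/J -> S/J' -> 0, the first map being multiplication by f. *)
Lemma cech_coboundary_regular J J' f j u :
  ideal J -> ideal J' -> (forall g, J (f * g) -> J g) -> J `<=` J' ->
  (forall p, J' p -> exists b, J (p - f * b)) -> J' f ->
  (forall j' v, j = j'.+1 -> cech_cocycle J' j' v -> cech_coboundary J' j' v) ->
  cech_cocycle J j u -> cech_coboundary J j (cech_scale f u) ->
  cech_coboundary J j u.
Proof.
move=> iJ iJ' reg JJ' J'dec J'f H [du zu] [_ [v [lv Hv]]].
have reg_loc F y : loc setT F (u F - y) ->
    loc J F (tofrac f * u F - tofrac f * y) -> loc J F (u F - y).
  by move=> l1; rewrite -mulrBr; apply: loc_regular.
split=> //; case: j => [|j] in du zu H Hv *.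
  exists 0; split=> [F|F Fj]; first by rewrite ffunE; apply: loc0.
  have d0 w : cech_diff w F = 0.
    by rewrite ffunE big1 // => i; rewrite (cards0_eq Fj) inE.
  rewrite d0; apply: reg_loc; first by apply: locB; [|apply: cech_deg_loc du|apply: loc0].
  by have := Hv F Fj; rewrite d0 cech_scaleE mulr0.
(* The component of [v] in degree [j] is a cocycle modulo [J']: its differential is congruent to f
   u, and f lies in [J']. *)
pose v' : cochain := [ffun F : {set 'I_n} => if #|F| == j then v F else 0].
have dv' G : #|G| = j.+1 -> cech_diff v' G = cech_diff v G.
  by move=> Gj; apply: eq_cech_diff => F; rewrite Gj => -[Fj]; rewrite ffunE Fj eqxx.
have [_ [z [lz Hz]]] : cech_coboundary J' j v'.
  apply: H => //; split=> [F|G Gj]; first by rewrite ffunE; case: eqP.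
  have -> : cech_diff v' G = tofrac f * u G - (tofrac f * u G - cech_diff v G).
    by rewrite subKr dv'.
  apply: locB => //.
    rewrite mulrC; apply: locM => //; [exact: cech_deg_loc du|exact: loc_tofrac].
  by apply: loc_subI JJ' _; rewrite -cech_scaleE; apply: Hv.
have Hy F : exists y, loc setT F y /\ (#|F| = j -> loc J F (v' F - cech_diff z F - tofrac f * y)).
  case: (eqVneq #|F| j) => [Fj|/eqP Fj]; last first.
    by exists 0; split=> //; apply: loc0.
  have [p [t [J'p ->]]] := Hz F Fj; have [b Jb] := J'dec p J'p.
  exists (tofrac b / tofrac (var_prod k F) ^+ t); split; first by exists b, t.
  by move=> _; exists (p - f * b), t; split=> //; rewrite rmorphB rmorphM mulrBl mulrA.
have [y0 Hy0] := choice Hy; pose y : cochain := finfun y0.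
exists y; split=> [F|G Gj]; first by rewrite ffunE; case: (Hy0 F).
apply: reg_loc.
  apply: locB => //; first exact: cech_deg_loc du.
  by apply: loc_cech_diff => // F; rewrite ffunE; case: (Hy0 F).
(* Since d d z = 0, f (u - d y) = (f u - d v) + d (v' - d z - f y), and y was chosen so that v' - d
   z - f y is 0 modulo [J] in degree [j]. *)
have -> : tofrac f * u G - tofrac f * cech_diff y G =
    (cech_scale f u G - cech_diff v G) + cech_diff (v' - cech_diff z - cech_scale f y) G.
  rewrite cech_scaleE -(dv' G Gj) !(cech_diffD, cochainDE).
  have dN w : cech_diff (- w) G = - cech_diff w G.
    rewrite !ffunE -sumrN; apply: eq_bigr => i _; by rewrite ffunE mulrN.
  rewrite !dN cech_diffZ cech_diffK [(0 : cochain) G]ffunE subr0 cech_scaleE.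
  by rewrite addrA subrK.
apply: locD => //; first exact: Hv.
rewrite ffunE; apply: loc_sum => // i iG; apply: locM => //; first exact: loc_sign.
apply: (loc_subset iJ (finset.subsetDl G [set i]%SET)).
rewrite !cochainDE [(- cech_diff z) _]ffunE [(- cech_scale f y) _]ffunE cech_scaleE.
rewrite [y _]ffunE; case: (Hy0 (G :\ i)%SET) => _; apply.
by move: Gj; rewrite (cardsD1 i) iG => -[].
Qed.

(** By induction on j, multiplication by the next f is injective on H^j, because H^(j-1) vanishes
    modulo one more element. A nonzero class would be killed by powers of all variables, so some
    multiple of it would be a nonzero class killed by the whole maximal ideal, hence by f. *)
Lemma regular_sequence_cech I fs : ideal I -> (forall f, f \in fs -> max_ideal f) ->
  regular_sequence I fs ->
  forall j u, (j < size fs)%N -> cech_cocycle I j u -> cech_coboundary I j u.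
Proof.
move=> iI mfs [reg _].
pose Jk i : set S := ideal_gen (I `|` [set` take i fs]).
have iJ i : ideal (Jk i) by apply: ideal_gen_ideal.
suff key j i u : (i + j < size fs)%N -> cech_cocycle (Jk i) j u -> cech_coboundary (Jk i) j u.
  move=> j u; have -> : I = Jk 0%N; last exact: (key j 0%N).
  rewrite /Jk take0 -[LHS](ideal_gen_id iI); congr ideal_gen.
  by apply/seteqP; split=> p; [left|case].
move: j i u; have step i j u : (i + j < size fs)%N ->
    (forall j' v, j = j'.+1 -> cech_cocycle (Jk i.+1) j' v -> cech_coboundary (Jk i.+1) j' v) ->
    cech_cocycle (Jk i) j u -> cech_coboundary (Jk i) j u; last first.
  elim=> [|j IH] i u ij; apply: step => // j' v [<-].
  by apply: IH; rewrite addSnnS.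
move=> ij IH cu; apply: contrapT => ncob.
have ilt : (i < size fs)%N by apply: leq_ltn_trans ij; rewrite leq_addr.
pose f := fs`_i; pose A := [set g : S | cech_coboundary (Jk i) j (cech_scale g u)].
have iA : ideal A.
  split=> [|p q Ap Aq|a p Ap] /=.
  - split; first by apply: cech_degZ; case: cu.
    exists 0; split=> [F|F _]; first by rewrite ffunE; apply: loc0.
    rewrite cech_scaleE rmorph0 mul0r; apply: locB => //; first exact: loc0.
    by apply: loc_cech_diff => // G; rewrite ffunE; apply: loc0.
  - by rewrite /A /= cech_scaleD; apply: cech_coboundaryD.
  - by rewrite /A /= -cech_scaleA; apply: cech_coboundaryZ.
have [||g [ng Ag]] := max_ideal_socle iA.
- by rewrite /A /= cech_scale1.
- by move=> i'; apply: cech_torsion.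
apply: ng; apply: (@cech_coboundary_regular (Jk i) (Jk i.+1) f) => //.
- exact: reg.
- apply: ideal_gen_min => // p [Ip|/= pf]; apply: sub_ideal_gen; [left|right] => //=.
  by rewrite (take_nth 0) // mem_rcons inE pf orbT.
- apply: (@ideal_gen_min _ _ [set p | exists b, Jk i (p - f * b)]) => [|p].
    split=> [|p q [a Ja] [b Jb]|a p [b Jb]] /=.
    + by exists 0; rewrite mulr0 subr0; case: (iJ i).
    + exists (a + b); rewrite mulrDr opprD addrACA.
      by case: (iJ i) => _ JD _; apply: JD.
    + by exists (a * b); rewrite mulrCA -mulrBr; apply: idealMl.
  case=> [Ip|/=]; first by exists 0; rewrite mulr0 subr0; apply: sub_ideal_gen; left.
  rewrite (take_nth 0) // mem_rcons inE => /orP[/eqP ->|pf].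
    by exists 1; rewrite mulr1 subrr; case: (iJ i).
  by exists 0; rewrite mulr0 subr0; apply: sub_ideal_gen; right.
- by apply: sub_ideal_gen; right; rewrite /= (take_nth 0) // mem_rcons inE eqxx.
- exact: cech_cocycleZ.
- by rewrite cech_scaleA; apply/Ag/mfs/mem_nth.
Qed.

End RegularSequences.

(** * Local cohomology of S/I^(l) *)

Section LaurentCoefficients.
Variables (k : fieldType) (n : nat).
Local Notation S := {mpoly k[n]}.
Local Notation Q := {fraction S}.
Implicit Types (F G : {set 'I_n}) (p s : S) (q : Q) (b m : 'X_{1..n}).
Local Notation xF F := (tofrac (var_prod k F)).

Lemma addmAC (m1 m2 m3 : 'X_{1..n}) : (m1 + m2 + m3 = m1 + m3 + m2)%MM.
Proof. by rewrite -!addmA (addmC m2). Qed.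

(* The coefficient of x^b in the Laurent polynomial q; the junk value 0 is
   taken when q is not a Laurent polynomial. *)
Definition lcoef b q : k :=
  match pselect (exists pt : S * nat, q = tofrac pt.1 / xF [set: 'I_n]%SET ^+ pt.2) with
  | left h => let pt := projT1 (cid h) in
      pt.1@_(b + expo [set: 'I_n]%SET *+ pt.2)
  | right _ => 0
  end.

(** Two representations of a Laurent polynomial differ by monomial factors, which shift exponents;
    so the coefficient may be read off over any x_F. *)
Lemma lcoefE b p F t : lcoef b (tofrac p / xF F ^+ t) = p@_(b + expo F *+ t).
Proof.
rewrite /lcoef; case: pselect => [h|[]]; last first.
  have : loc [set: S] [set: 'I_n]%SET (tofrac p / xF F ^+ t).
    apply: loc_subset (finset.subsetT F) _; first exact: idealT.
    by exists p, t.
  by move=> [p' [t' [_ ->]]]; exists (p', t').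
case: (cid h) => -[p' t'] /= /eqP.
rewrite eqr_div ?xF_neq0 // -!rmorphXn -!rmorphM tofrac_eq !var_prodXE => /eqP E.
by rewrite -(mcoeffMXr p' _ (expo F *+ t)) -E addmAC mcoeffMXr.
Qed.

Lemma lcoef_tofrac b p : lcoef b (tofrac p) = p@_b.
Proof.
by rewrite -[tofrac p]divr1 -(expr0 (xF finset.set0)) lcoefE addm0.
Qed.

Lemma lcoef0 b : lcoef b 0 = 0.
Proof. by rewrite -(rmorph0 (@tofrac S)) lcoef_tofrac mcoeff0. Qed.

Lemma lcoefD b q1 q2 F G : loc setT F q1 -> loc setT G q2 ->
  lcoef b (q1 + q2) = lcoef b q1 + lcoef b q2.
Proof.
move=> /(loc_subset (@idealT _ _) (finset.subsetT F)) [p1 [t1 [_ ->]]].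
move=> /(loc_subset (@idealT _ _) (finset.subsetT G)) [p2 [t2 [_ ->]]].
set x := var_prod k _; rewrite addf_div ?xF_neq0 // -exprD.
have -> : tofrac p1 * tofrac x ^+ t2 + tofrac p2 * tofrac x ^+ t1 =
    tofrac (p1 * x ^+ t2 + p2 * x ^+ t1) by rewrite rmorphD !rmorphM !rmorphXn.
rewrite !lcoefE mcoeffD !var_prodXE.
have -> : (expo [set: 'I_n]%SET *+ (t1 + t2) =
    expo [set: 'I_n]%SET *+ t1 + expo [set: 'I_n]%SET *+ t2)%MM.
  by apply/mnmP => i; rewrite mnmDE !mulmnE mulnDr.
by rewrite addmA mcoeffMXr addmAC mcoeffMXr.
Qed.

Lemma lcoefZ b a q F : loc setT F q -> lcoef b (tofrac a%:MP * q) = a * lcoef b q.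
Proof.
by move=> [p [t [_ ->]]]; rewrite mulrA -rmorphM !lcoefE mcoeffCM.
Qed.

Lemma lcoefP b a q1 q2 F : loc setT F q1 -> loc setT F q2 ->
  lcoef b (tofrac a%:MP * q1 + q2) = a * lcoef b q1 + lcoef b q2.
Proof.
move=> H1 H2; rewrite -(lcoefZ _ _ H1) (@lcoefD _ _ _ F F) //.
by apply: locM => //; apply: loc_tofrac.
Qed.

Lemma lcoefB b q1 q2 F G : loc setT F q1 -> loc setT G q2 ->
  lcoef b (q1 - q2) = lcoef b q1 - lcoef b q2.
Proof.
move=> H1 H2; have -> : - q2 = tofrac (-1)%:MP * q2.
  by rewrite rmorphN1 rmorphN1 mulN1r.
rewrite (@lcoefD _ _ _ F G) ?(lcoefZ _ _ H2) ?mulN1r //.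
by apply: locM => //; apply: loc_tofrac.
Qed.

Lemma lcoef_thick b F G l q : loc (thick F l) G q -> G \subset F -> (wt F b < l)%N ->
  lcoef b q = 0.
Proof.
move=> [p [t [/thickP Tp ->]]] GF wb; rewrite lcoefE Tp //.
by rewrite wtD wtMn wt_expo; move: GF; rewrite -finset.setD_eq0 => /eqP ->; rewrite cards0 addn0.
Qed.

(** The product of s with the component of p in the degree of m is nonzero, and the other components
    of p cannot cancel it. This handles [frac_homog], whose denominators are arbitrary homogeneous
    polynomials. *)
Lemma homog_quotient p s r E d m : r \is E.-homog -> s \is d.-homog -> s != 0 ->
  p * s = r -> m \in msupp p -> (mdeg m + d = E)%N.
Proof.
move=> /dhomogP hr /dhomogP hs s0 psr mp.
set pe := part (fun m' => mdeg m' == mdeg m) p.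
have pe0 : pe != 0.
  apply/eqP => /(congr1 (mcoeff m)); rewrite mcoeff_part eqxx mcoeff0 => /eqP.
  by rewrite mcoeff_eq0 mp.
have : pe * s != 0 by rewrite mulf_neq0.
rewrite -msupp_eq0; case Em : (msupp (pe * s)) => [//|m' w] _.
have m's : m' \in msupp (pe * s) by rewrite Em inE eqxx.
have dm' : (mdeg m' = mdeg m + d)%N.
  have /allpairsP[[x y] /= [hx hy ->]] := msuppM_le m's.
  move: hx; rewrite mcoeff_msupp mcoeff_part; case: ifP => [/eqP dx _|]; last by rewrite eqxx.
  by rewrite mdegD dx; congr (_ + _)%N; apply: hs.
rewrite -dm'; apply: (hr m'); rewrite -psr mcoeff_msupp.
have -> : p * s = pe * s + (p - pe) * s by rewrite -mulrDl addrC subrK.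
rewrite mcoeffD [X in _ + X]memN_msupp_eq0 ?addr0 -?mcoeff_msupp //.
apply/negP => /msuppM_le/allpairsP[[x y] /= [hx hy E']].
move: dm'; rewrite E' mdegD (hs y hy : mdeg y = d) => /addIn dx.
by move: hx; rewrite mcoeff_msupp mcoeffB mcoeff_part dx eqxx subrr eqxx.
Qed.

Lemma lcoef_homog b d q F : loc setT F q -> frac_homog d q -> d != (mdeg b)%:Z ->
  lcoef b q = 0.
Proof.
move=> [p [t [_ qE]]] [r [s [dp [ds [hr hs s0 qE' dE]]]]] db.
rewrite qE lcoefE; apply/eqP; apply: contraNT db; rewrite -mcoeff_msupp => mp.
have E : p * s = r * 'X_[expo F *+ t].
  apply/eqP; rewrite -var_prodXE -tofrac_eq !rmorphM rmorphXn -eqr_div ?tofrac_eq0 ?xF_neq0 //.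
  by rewrite -qE qE'.
have hX : 'X_[k, expo F *+ t] \is (mdeg (expo F *+ t)).-homog by rewrite dhomogX.
have := homog_quotient (dhomogM hr hX) hs s0 E mp.
rewrite dE mdegD => {}E; apply/eqP; move: E; clear; lia.
Qed.

End LaurentCoefficients.

(** * Vanishing and explicit classes in degrees 0, 1 and 2 *)

Section LocalCohomology.
Variables (k : fieldType) (n : nat) (D : {set {set 'I_n}}) (l : nat).
Local Notation S := {mpoly k[n]}.
Local Notation Q := {fraction S}.
Local Notation cochain := (cech_cochain k n).
Local Notation I := (fat (k := k) D l).
Implicit Types (C F G : {set 'I_n}) (p f : S) (q : Q) (u v : cochain) (b m : 'X_{1..n}).
Local Notation xF F := (tofrac (var_prod k F)).

Lemma fat_loc F G q : facet D F -> loc I G q -> loc (thick F l) G q.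
Proof. by move=> fF; apply: loc_subI => p; apply. Qed.

(** As x_G is not in the prime of F, it is a nonzerodivisor modulo the primary ideal [thick F l]. *)
Lemma loc_thickP F G p t : G \subset F -> loc (thick F l) G (tofrac p / xF G ^+ t) ->
  thick F l p.
Proof.
move=> GF [a [s [Ta /eqP]]].
rewrite eqr_div ?xF_neq0 // -!rmorphXn -!rmorphM tofrac_eq => /eqP E.
apply: (@thick_primary _ _ F l (var_prod k G ^+ s)).
  rewrite var_prodXE => /thickX; rewrite wtMn wt_expo.
  by move: GF; rewrite -finset.setD_eq0 => /eqP ->; rewrite cards0.
by rewrite mulrC E; apply: (idealMr _ (thick_ideal k F l)).
Qed.

(** Facets not containing G impose no condition after localization: x_G lies in their primes, so the
    factor x_G^l brings the numerator into their l-th powers. *)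
Lemma loc_fat G p t : (forall F, facet D F -> G \subset F -> thick F l p) ->
  loc I G (tofrac p / xF G ^+ t).
Proof.
move=> H; exists (p * var_prod k G ^+ l), (t + l)%N; split; last first.
  by rewrite rmorphM rmorphXn exprD -mulf_div divff ?mulr1 // xF_neq0.
move=> F fF; case: (boolP (G \subset F)) => GF.
  by apply: (idealMr _ (thick_ideal k F l)); apply: H.
apply: (idealMl _ (thick_ideal k F l)); rewrite var_prodXE; apply/thickX.
rewrite wtMn wt_expo -[X in (X <= _)%N]mul1n leq_mul2r.
by rewrite card_gt0 finset.setD_eq0 GF orbT.
Qed.

Lemma mdeg_expo F : mdeg (expo F) = #|F|.
Proof.
rewrite mdegE -sum1_card [RHS]big_mkcond; apply: eq_bigr => h _.
by rewrite expoE; case: ifP.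
Qed.

Lemma cech_diff1 u i : cech_diff u [set i]%SET = u finset.set0.
Proof.
rewrite ffunE big_set1 finset.setDv (_ : #|_| = 0%N) ?mul1r //.
by apply: eq_card0 => h; rewrite !inE; case: eqP => [->|//]; rewrite ltnn.
Qed.

Lemma cech_diff2 u (i j : 'I_n) : (i < j)%N ->
  cech_diff u [set i; j]%SET = u [set j]%SET - u [set i]%SET.
Proof.
move=> ij; have nij : i != j by apply: contraTneq ij => ->; rewrite ltnn.
have card0 (G : {set 'I_n}) h : (forall g, g \in G -> ~~ (g < h)%N) ->
    #|[pred g in G | (g < h)%N]| = 0%N.
  by move=> H; apply: eq_card0 => g; rewrite !inE; case: (boolP (g \in G)) => //= /H /negPf.
rewrite ffunE big_setU1 ?inE //= big_set1 card0 ?mul1r => [|g].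
  rewrite (sgD1 k j (finset.setU11 _ _)) ij finset.setU1K ?inE // card0 => [|g].
    rewrite mulr1 mulN1r; congr (_ - u _).
    apply/setP => g; rewrite !inE; case: (eqVneq g j) => [->|_]; rewrite ?orbF //.
    by rewrite eq_sym (negPf nij).
  by rewrite inE => /eqP ->; rewrite ltnn.
by rewrite !inE => /orP[] /eqP ->; rewrite ?ltnn // -leqNgt ltnW.
Qed.

(** A 0-cocycle is a polynomial that lies in I locally at each x_i; testing a facet at one of its
    own vertices puts the polynomial in I. *)
Lemma cech_cocycle0 u : (forall F, facet D F -> F != finset.set0) ->
  cech_cocycle I 0 u -> cech_coboundary I 0 u.
Proof.
move=> F0 [du zu]; split=> //; exists 0; split=> [F|_ /cards0_eq ->].
  by rewrite ffunE; apply: loc0.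
have -> : cech_diff (0 : cochain) finset.set0 = 0.
  by rewrite ffunE big1 // => i; rewrite inE.
rewrite subr0; have := du finset.set0; rewrite cards0 eqxx => -[p [t [_ uE]]].
rewrite uE; apply: loc_fat => F fF _.
have [i iF] := finset.set0Pn _ (F0 F fF).
have := zu [set i]%SET (cards1 i); rewrite cech_diff1 uE => /(fat_loc fF).
have -> : xF finset.set0 ^+ t = xF [set i]%SET ^+ 0.
  by rewrite /var_prod finset.big_set0 rmorph1 expr1n expr0.
by apply: loc_thickP; rewrite finset.sub1set.
Qed.

(** Over a common exponent t the components are p_i / x_i^t, and the cocycle condition on pairs is
    the hypothesis of [glue]; the polynomial c obtained is the required 0-cochain. *)
Lemma cech_cocycle1 u : (forall F, facet D F -> #|F| = 2%N) -> ~ disconnected D l ->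
  cech_cocycle I 1 u -> cech_coboundary I 1 u.
Proof.
move=> pureD conn [du zu].
have [t Ht] : exists t, forall i, exists p : S, u [set i]%SET = tofrac p / xF [set i]%SET ^+ t.
  apply: finite_uniform => [i|i s t st [p ->]].
    by have := du [set i]%SET; rewrite cards1 eqxx => -[p [t [_ ->]]]; exists t, p.
  exists (p * var_prod k [set i]%SET ^+ (t - s)).
  rewrite -{2}(subnKC st) exprD rmorphM rmorphXn -mulf_div divff ?mulr1 //.
  exact: xF_neq0.
have [p Hp] := choice Ht.
have Xi i : var_prod k [set i]%SET = 'X_i by rewrite /var_prod big_set1.
have [c Hc] : exists c, forall F i, facet D F -> i \in F -> thick F l (p i - c * 'X_i ^+ t).
  apply: glue => // F.
  suff H i j : facet D F -> i \in F -> j \in F -> (i < j)%N ->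
      thick F l (p j * 'X_i ^+ t - p i * 'X_j ^+ t).
    move=> i j fF iF jF; case: (ltngtP i j) => [ij|ji|/val_inj ->]; first exact: H.
      by rewrite -opprB; apply: (idealN (thick_ideal k F l)); apply: H.
    by rewrite subrr; case: (thick_ideal k F l).
  move=> fF iF jF ij.
  have nij : i != j by apply: contraTneq ij => ->; rewrite ltnn.
  have G2 : #|[set i; j]%SET| = 2%N by rewrite cards2 nij.
  have := zu _ G2; rewrite cech_diff2 // !Hp -mulNr addf_div ?xF_neq0 //.
  have -> : xF [set j]%SET ^+ t * xF [set i]%SET ^+ t = xF [set i; j]%SET ^+ t.
    by rewrite -exprMn -rmorphM mulrC !Xi /var_prod big_setU1 ?inE ?big_set1.
  rewrite mulNr !Xi -!rmorphXn -!rmorphM -rmorphB rmorphXn => /(fat_loc fF).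
  by apply: loc_thickP; rewrite finset.subUset !finset.sub1set iF.
split=> //; exists [ffun F => tofrac c]; split=> [F|F /eqP/cards1P[i ->]].
  by rewrite ffunE; apply: loc_tofrac.
rewrite cech_diff1 ffunE Hp.
have -> : tofrac (p i) / xF [set i]%SET ^+ t - tofrac c =
    tofrac (p i - c * 'X_i ^+ t) / xF [set i]%SET ^+ t.
  by rewrite rmorphB rmorphM mulrBl rmorphXn Xi mulfK // -Xi xF_neq0.
by apply: loc_fat => F' fF'; rewrite finset.sub1set; apply: Hc.
Qed.

Hypothesis card_facet : forall F, facet D F -> (0 < #|F| <= 2)%N.

(** The cochain u is x^b times the indicator function of [C]. On a pair crossing [C] its
    differential is x^b up to sign, which vanishes in the localization because no facet of weight
    less than [l] contains the pair. The functional compares the coefficients at b at a vertex of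
    [F1] and at one of [F2]; for a coboundary both equal the coefficient of the same 0-cochain. *)
Lemma disconnected_class : disconnected D l ->
  exists u phi, [/\ lc_dual I 1 phi, cech_cocycle I 1 u &
    forall f, phi (cech_scale f u) = f@_0%MM].
Proof.
move=> [b [C [F1 [F2 [[fF1 fF2 w1 w2] [F1C F2C Cdich]]]]]].
have [i iF1] : exists i, i \in F1 by apply/card_gt0P; case/andP: (card_facet fF1).
have [j jF2] : exists j, j \in F2 by apply/card_gt0P; case/andP: (card_facet fF2).
have iC := fintype.subsetP F1C i iF1; have := fintype.subsetP F2C j jF2.
rewrite inE => jC.
pose side g : Q := if g \in C then tofrac 'X_[b] else 0.
(* The sum is [side g] if G is the singleton of g, and is empty otherwise. *)
pose u : cochain := [ffun G : {set 'I_n} => \sum_(g | G == [set g]%SET) side g].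
have u1 g : u [set g]%SET = side g.
  by rewrite ffunE (big_pred1 g) // => h; rewrite /= (inj_eq finset.set1_inj) eq_sym.
pose phi v := lcoef b (v [set i]%SET) - lcoef b (v [set j]%SET).
have l1 v g : cech_deg 1 v -> loc setT [set g]%SET (v [set g]%SET).
  by move=> dv; apply: cech_deg_loc dv.
have Il : ideal I by apply: fat_ideal.
exists u, phi; split.
- split.
  + move=> a v w [dv _] [dw _]; rewrite /phi !cochainDE !cech_scaleE.
    by rewrite !(lcoefP _ _ (l1 _ _ dv) (l1 _ _ dw)); ring.
  + move=> v [dv [w [lw Hw]]].
    have H g F : facet D F -> (wt F b < l)%N -> g \in F ->
        lcoef b (v [set g]%SET) = lcoef b (w finset.set0).
      move=> fF wF gF; have := Hw [set g]%SET (cards1 g); rewrite cech_diff1.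
      move/(fat_loc fF)/(@lcoef_thick _ _ b); rewrite finset.sub1set => /(_ gF wF).
      by rewrite (lcoefB _ (l1 _ _ dv) (lw _)) => /eqP; rewrite subr_eq0 => /eqP.
    by rewrite /phi (H i F1) // (H j F2) // subrr.
  + exists (mdeg b)%:Z => d v dN [dv _] hv.
    have db : d != (mdeg b)%:Z by move: dN; clear; lia.
    by rewrite /phi !(lcoef_homog (l1 _ _ dv) (hv _) db) subrr.
- split=> [F|G].
    case: ifP => [/cards1P[g ->]|F1'].
      by rewrite u1 /side; case: ifP => _; [apply: loc_tofrac|apply: loc0].
    by rewrite ffunE big_pred0 // => g; apply/negP => /eqP FE; rewrite FE cards1 in F1'.
  move/eqP/cards2P => [x [y [xy ->]]].
  wlog xy' : x y xy / (x < y)%N.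
    case: (ltngtP x y) => [lt|gt|/val_inj E]; last by rewrite E eqxx in xy.
      exact.
    by move=> /(_ y x); rewrite finset.setUC; apply=> //; rewrite eq_sym.
  rewrite cech_diff2 // !u1.
  have Xb : (x \in C) != (y \in C) -> loc I [set x; y]%SET (tofrac 'X_[b]).
    move=> nxy; rewrite -[tofrac _]divr1 -(expr0 (xF [set x; y]%SET)).
    apply: loc_fat => F fF xyF; apply/thickX; rewrite leqNgt; apply/negP => wF.
    move: xyF; rewrite finset.subUset !finset.sub1set => /andP[xF yF].
    case: (Cdich F fF wF) => /fintype.subsetP FC; move: (FC x xF) (FC y yF) nxy.
      by move=> -> ->.
    by rewrite !inE => /negPf -> /negPf ->.
  rewrite /side; case: (boolP (x \in C)) Xb => xC; case: (boolP (y \in C)) => yC Xb.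
  + by rewrite subrr; apply: loc0.
  + by rewrite sub0r; apply: locN => //; apply: Xb.
  + by rewrite subr0; apply: Xb.
  + by rewrite subrr; apply: loc0.
- move=> f; rewrite /phi !cech_scaleE !u1 /side iC (negPf jC) mulr0 lcoef0 subr0.
  by rewrite -rmorphM lcoef_tofrac -[in X in _@_X](add0m b) mcoeffMXr.
Qed.

(** The functional is a residue, the coefficient of the component at E at x_E^(-1); multiplying by
    x_E first keeps exponents nonnegative. It kills coboundaries, since a fraction over one vertex
    of E has no negative exponent at the other, and it kills I, since this exponent has weight 0
    outside E. If x^m is a monomial of f in the variables of E, the class of x^(-m) x_E^(-1) detects
    the coefficient of f at m. *)
Lemma top_class E : facet D E -> #|E| = 2%N -> (0 < l)%N ->
  exists2 phi, lc_dual I 2 phi &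
    forall f, ~ thick E 1 f -> exists2 u, cech_cocycle I 2 u & phi (cech_scale f u) != 0.
Proof.
move=> fE E2 l0; have [i [j [ij Eij]]] : exists i j : 'I_n, (i < j)%N /\ E = [set i; j]%SET.
  move/eqP/cards2P: E2 => [x [y [xy ->]]].
  case: (ltngtP x y) => [lt|gt|/val_inj E']; last by rewrite E' eqxx in xy.
    by exists x, y.
  by exists y, x; rewrite finset.setUC.
pose phi v := lcoef 0%MM (xF E * v E).
have Il : ideal I by apply: fat_ideal.
have lx q : loc setT E q -> loc setT E (xF E * q).
  by move=> H; apply: locM => //; apply: loc_tofrac.
have l2 v : cech_deg 2 v -> loc setT E (v E) by move=> dv; apply: cech_deg_loc dv.
exists phi.
  split.
  + move=> a v w [dv _] [dw _]; rewrite /phi cochainDE cech_scaleE mulrDr.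
    by rewrite (mulrCA (xF E)) (lcoefP _ _ (lx _ (l2 _ dv)) (lx _ (l2 _ dw))).
  + move=> v [dv [w [lw Hw]]].
    have := Hw E E2; rewrite Eij cech_diff2 // -Eij => H.
    have w0 g h : g \in E -> h \in E -> h != g -> lcoef 0%MM (xF E * w [set g]%SET) = 0.
      move=> gE hE hg; have [p [t [_ ->]]] := lw [set g]%SET.
      rewrite mulrA -rmorphM lcoefE mulrC var_prodE mcoeffMX_eq0 //.
      apply/negP => /mnm_lepP /(_ h); rewrite add0m mulmnE !expoE hE inE (negPf hg).
      by rewrite mul0n.
    have iE : i \in E by rewrite Eij !inE eqxx.
    have jE : j \in E by rewrite Eij !inE eqxx orbT.
    have nij : i != j by apply: contraTneq ij => ->; rewrite ltnn.
    have {}H : lcoef 0%MM (xF E * (v E - (w [set j]%SET - w [set i]%SET))) = 0.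
      apply: (@lcoef_thick _ _ _ E E l); rewrite ?wt0 //.
      by apply: (fat_loc fE); apply: locM => //; apply: loc_tofrac.
    have lw' g : g \in E -> loc setT E (xF E * w [set g]%SET).
      move=> gE; apply: lx; apply: loc_subset (lw _) => //.
      by rewrite finset.sub1set.
    move: H; rewrite mulrBr mulrBr !(@lcoefB _ _ _ _ _ E E) //.
    * rewrite (w0 i j) // 1?eq_sym // (w0 j i) // !subr0; exact.
    * exact: lw'.
    * exact: lw'.
    * exact: lx (l2 _ _).
    * by apply: locB => //; apply: lw'.
  (* The monomial x_E^(-1) has degree -2, so the functional vanishes in all other degrees. *)
  + exists 2 => d v dN [dv _] hv; rewrite /phi.
    have hx : frac_homog (d + 2) (xF E * v E).
      have [r [s [dr [ds [hr hs s0 -> ->]]]]] := hv E.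
      exists (var_prod k E * r), s, (2 + dr)%N, ds; split=> //.
      * apply: dhomogM => //; rewrite var_prodE dhomogX -E2 -mdeg_expo.
        exact: eqxx.
      * by rewrite rmorphM mulrA.
      * lia.
    apply: (lcoef_homog _ hx); first exact: lx (l2 _ _).
    by rewrite mdeg0; lia.
move=> f nf; have [m mf wm] : exists2 m, m \in msupp f & wt E m = 0%N.
  apply: contrapT => H; apply: nf => m mf; rewrite lt0n; apply/eqP => wm.
  by apply: H; exists m.
(* This N makes x_E^N divisible by x^m, so that x^(-m) can be written over x_E^N. *)
pose N := mdeg m.
have mN : (m <= expo E *+ N)%MM.
  apply/mnm_lepP => g; rewrite mulmnE expoE.
  case: (boolP (g \in E)) => gE; first by rewrite mul1n /N mdegE (bigD1 g) //= leq_addr.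
  by move/eqP: wm; rewrite sum_nat_eq0 => /forall_inP/(_ g); rewrite inE => /(_ gE)/eqP ->.
pose q : Q := tofrac 'X_[expo E *+ N - m] / xF E ^+ N.+1.
pose u : cochain := [ffun G => if G == E then q else 0].
have du G : loc setT G (u G).
  rewrite ffunE; case: eqP => [->|_]; last exact: loc0.
  by exists 'X_[expo E *+ N - m], N.+1.
exists u; first split=> [G|G G3].
- case: ifP => // G2; rewrite ffunE; case: eqP => // GE.
  by rewrite GE E2 eqxx in G2.
(* No facet contains the three elements of G, so the localization of S/I at x_G is zero. *)
- have [p [t [_ ->]]] := loc_cech_diff G (@idealT _ _) du.
  apply: loc_fat => F fF /subset_leq_card; rewrite G3.
  by have /andP[_ F2] := card_facet fF; rewrite leqNgt ltnS F2.
have -> : phi (cech_scale f u) = f@_m; last by rewrite -mcoeff_msupp.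
rewrite /phi cech_scaleE ffunE eqxx /q exprS invfM.
have -> : xF E * (tofrac f * (tofrac 'X_[expo E *+ N - m] * ((xF E)^-1 / xF E ^+ N))) =
    tofrac (f * 'X_[expo E *+ N - m]) / xF E ^+ N.
  set x := xF E; have x0 : x != 0 by have := xF_neq0 k E 1; rewrite expr1.
  by rewrite (mulrCA x) (mulrCA x) mulVKf // rmorphM mulrA.
by rewrite lcoefE add0m -[in X in _@_X](submK mN) [(_ + m)%MM]addmC mcoeffMXr.
Qed.

End LocalCohomology.

(** * Depth and S_2-depth *)

Section RegularElements.
Variables (k : fieldType) (n : nat) (D : {set {set 'I_n}}) (l : nat).
Local Notation S := {mpoly k[n]}.
Local Notation I := (fat (k := k) D l).
Implicit Types (F G : {set 'I_n}) (p f g : S).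
Hypothesis l0 : (0 < l)%N.
Hypothesis hD : simplicial_complex D.
Hypothesis facet0 : forall F, facet D F -> F != finset.set0.

(** Generic linear forms may fail to exist over a finite field; symmetric polynomials serve over
    every field. *)
Definition esym1 : S := \sum_i 'X_i.
Definition esym2 : S := \sum_(G : {set 'I_n} | #|G| == 2%N) var_prod k G.

Lemma max_ideal_thick f : max_ideal f -> thick finset.set0 1 f.
Proof.
apply: ideal_gen_min; first exact: thick_ideal.
by move=> _ [i _ <-]; apply/thickX; rewrite wtU inE.
Qed.

Lemma max_idealX i : max_ideal ('X_i : S).
Proof. by apply: sub_ideal_gen; exists i. Qed.

Lemma max_ideal_esym1 : max_ideal esym1.
Proof.
by apply: ideal_sum => [|i _]; [apply: ideal_gen_ideal|apply: max_idealX].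
Qed.

Lemma max_ideal_esym2 : max_ideal esym2.
Proof.
have iM : ideal (@max_ideal k n) by apply: ideal_gen_ideal.
apply: ideal_sum => // G G2.
have [i iG] : exists i, i \in G by apply/card_gt0P; rewrite (eqP G2).
by rewrite /var_prod (bigD1 i) //=; apply: idealMr => //; apply: max_idealX.
Qed.

Lemma exists_facet : exists F, facet D F.
Proof. by case: hD => -[F FD] _; have [G fG _] := face_facet FD; exists G. Qed.

(** Everything lies in [thick finset.set0 1], the polynomials without constant term: I does because
    the weight outside a facet is at most the total degree. *)
Lemma proper_gen (fs : seq S) : (forall f, f \in fs -> max_ideal f) ->
  ~ ideal_gen (I `|` [set` fs]) 1.
Proof.
move=> mfs; suff H : ideal_gen (I `|` [set` fs]) `<=` thick finset.set0 1.
  by move/H; apply: thick1_1.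
apply: ideal_gen_min; first exact: thick_ideal.
move=> f [If|/mfs]; last exact: max_ideal_thick.
have [F fF] := exists_facet.
move=> m /(If F fF) lm; apply: leq_trans (leq_trans l0 lm) _.
rewrite /wt big_mkcond [X in (_ <= X)%N]big_mkcond; apply: leq_sum => i _.
by rewrite !inE; case: ifP.
Qed.

(** The coefficient 1 at a vertex of F keeps [esym1] out of the prime of F, for every facet F. *)
Lemma esym1_regular g : I (esym1 * g) -> I g.
Proof.
move=> H F fF; have [i iF] := finset.set0Pn _ (facet0 fF).
apply: thick_primary (H F fF) => /thickP /(_ U_(i)%MM); rewrite wtU iF => /(_ isT).
rewrite /esym1 raddf_sum /= (bigD1 i) //= mcoeffXU eqxx big1 ?addr0 => [/eqP|j ji].
  by rewrite oner_eq0.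
by rewrite mcoeffXU (negPf ji).
Qed.

Lemma regular_sequence1 : regular_sequence I [:: esym1].
Proof.
split=> [[|//] _ g /=|]; last first.
  by apply: proper_gen => f; rewrite inE => /eqP ->; apply: max_ideal_esym1.
have -> : ideal_gen (I `|` [set` [::]]) = I.
  rewrite -[RHS](ideal_gen_id (fat_ideal k D l)); congr ideal_gen.
  by apply/seteqP; split=> p; [case|left].
exact: esym1_regular.
Qed.

Hypothesis pureD : forall F, facet D F -> #|F| = 2%N.
Hypothesis conn : ~ disconnected D l.

(* Modulo the prime of a facet {a, b} the two symmetric polynomials become
   x_a + x_b and x_a x_b, the coefficients of the polynomial with roots x_a, x_b. *)
Lemma esym_cubic i :
  fat D 1 ('X_i ^+ 3 - 'X_i ^+ 2 * esym1 + 'X_i * esym2).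
Proof.
move=> F fF; have iT := thick_ideal k F 1.
case: (boolP (i \in F)) => iF; last first.
  have -> : 'X_i ^+ 3 - 'X_i ^+ 2 * esym1 + 'X_i * esym2 =
     'X_i * ('X_i ^+ 2 - 'X_i * esym1 + esym2) by ring.
  by apply: (idealMr _ iT); apply/thickX; rewrite wtU iF.
have [j jF FE] : exists2 j, j != i & F = [set i; j]%SET.
  have /eqP/cards2P[x [y [xy FE]]] := pureD fF.
  move: iF; rewrite FE !inE => /orP[] /eqP ->; first by exists y; rewrite // eq_sym.
  by exists x; rewrite // finset.setUC.
have h1 : thick F 1 (esym1 - ('X_i + 'X_j)).
  rewrite /esym1 (bigID (fun h => h \in F)) /=.
  have -> : \sum_(h in F) 'X_h = 'X_i + 'X_j :> S.
    by rewrite FE big_setU1 ?big_set1 // inE eq_sym.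
  rewrite addrAC subrr add0r; apply: ideal_sum => // h hF.
  by apply/thickX; rewrite wtU hF.
have h2 : thick F 1 (esym2 - 'X_i * 'X_j).
  rewrite /esym2 (bigD1 F) ?pureD //=.
  have -> : var_prod k F = 'X_i * 'X_j.
    by rewrite /var_prod FE big_setU1 ?big_set1 // inE eq_sym.
  rewrite addrAC subrr add0r; apply: ideal_sum => // G /andP[G2 GF].
  rewrite var_prodE; apply/thickX; rewrite wt_expo card_gt0 finset.setD_eq0.
  by apply: contra GF => GF; rewrite eqEcard GF (eqP G2) pureD.
have -> : 'X_i ^+ 3 - 'X_i ^+ 2 * esym1 + 'X_i * esym2 =
    'X_i * (esym2 - 'X_i * 'X_j) - 'X_i ^+ 2 * (esym1 - ('X_i + 'X_j)) by ring.
by apply: (idealB iT); apply: (idealMl _ iT).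
Qed.

Lemma fatX_pow p : fat D 1 p -> I (p ^+ l).
Proof.
move=> Hp F fF; elim: l => [|e IH]; first exact: thick0.
by rewrite exprS; apply: (@thickM _ _ _ 1) => //; apply: Hp.
Qed.

(** The l-th power of the cubic relation lies in I, so x_i^(3l) g is congruent to some e_1 a_i
    modulo I for every i. Cancelling e_1 shows that the fractions a_i / x_i^(3l) are compatible;
    they glue to a polynomial c, and g - e_1 c lies in I because x_i is a nonzerodivisor modulo the
    powers of the primes of facets through i. *)
Lemma esym2_regular g : ideal_gen (I `|` [set` [:: esym1]]) (esym2 * g) ->
  ideal_gen (I `|` [set` [:: esym1]]) g.
Proof.
set J := ideal_gen _; have iJ : ideal J by apply: ideal_gen_ideal.
have iI : ideal I := fat_ideal k D l.
have JI p : I p -> J p by move=> Ip; apply: sub_ideal_gen; left.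
have J1 : J esym1 by apply: sub_ideal_gen; right; rewrite /= inE eqxx.
have Jdec p : J p -> exists a, I (p - esym1 * a).
  apply: (@ideal_gen_min _ _ [set p | exists a, I (p - esym1 * a)]) => [|q].
    split=> [|p1 p2 [a1 H1] [a2 H2]|b p1 [a1 H1]] /=.
    - by exists 0; rewrite mulr0 subr0; case: iI.
    - exists (a1 + a2); rewrite mulrDr opprD addrACA.
      by apply: (idealD iI).
    - by exists (b * a1); rewrite mulrCA -mulrBr; apply: (idealMl _ iI).
  case=> [Iq|/=]; first by exists 0; rewrite mulr0 subr0.
  by rewrite inE => /eqP ->; exists 1; rewrite mulr1 subrr; case: iI.
move=> J2g; pose t := (3 * l)%N.
have Xg i : exists a, I ('X_i ^+ t * g - esym1 * a).
  apply: Jdec; set s := 'X_i ^+ 3 - 'X_i ^+ 2 * esym1 + 'X_i * esym2.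
  have [r Er] : exists r, ('X_i ^+ 3) ^+ l - s ^+ l = ('X_i ^+ 3 - s) * r.
    by rewrite subrXX; eexists.
  have -> : 'X_i ^+ t * g = s ^+ l * g + esym1 * ('X_i ^+ 2 * r * g) - esym2 * g * ('X_i * r).
    rewrite /t exprM -[in LHS](subrK (s ^+ l) (('X_i ^+ 3) ^+ l)) Er.
    by rewrite {1}/s; ring.
  apply: (idealB iJ); last exact: (idealMr _ iJ).
  apply: (idealD iJ); last exact: (idealMr _ iJ).
  by apply: (idealMr _ iJ); apply/JI/fatX_pow/esym_cubic.
have [a Ha] := choice Xg.
have [c Hc] : exists c, forall F i, facet D F -> i \in F -> thick F l (a i - c * 'X_i ^+ t).
  apply: (glue pureD conn) => F i j fF _ _; apply: (esym1_regular _ fF).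
  have -> : esym1 * (a j * 'X_i ^+ t - a i * 'X_j ^+ t) =
    'X_j ^+ t * ('X_i ^+ t * g - esym1 * a i) - 'X_i ^+ t * ('X_j ^+ t * g - esym1 * a j) by ring.
  by apply: (idealB iI); apply: (idealMl _ iI).
have Igc : I (g - esym1 * c).
  move=> F fF; have [i iF] := finset.set0Pn _ (facet0 fF).
  apply: (@thick_primary _ _ F l ('X_i ^+ t)).
    by rewrite mpolyXn => /thickX; rewrite wtMn wtU iF.
  have -> : 'X_i ^+ t * (g - esym1 * c) =
    ('X_i ^+ t * g - esym1 * a i) + esym1 * (a i - c * 'X_i ^+ t) by ring.
  apply: (idealD (thick_ideal k F l)); first exact: Ha.
  by apply: (idealMl _ (thick_ideal k F l)); apply: Hc.
rewrite -(subrK (esym1 * c) g); apply: (idealD iJ); first exact: JI.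
exact: (idealMr _ iJ).
Qed.

Lemma regular_sequence2 : regular_sequence I [:: esym1; esym2].
Proof.
have [reg1 _] := regular_sequence1.
split=> [[_|[_|//]] g|]; first exact: (reg1 0%N).
  exact: esym2_regular.
apply: proper_gen => f; rewrite !inE => /orP[] /eqP ->.
  exact: max_ideal_esym1.
exact: max_ideal_esym2.
Qed.

End RegularElements.

(** * Suprema and infima of sets of naturals in the extended integers *)

Section Suprema.
Implicit Types (A : set nat) (x : \bar int).

Lemma supremum_nat x A r : A r -> (forall s, A s -> (s <= r)%N) ->
  supremum x [set (j%:Z)%:E | j in A] = (r%:Z)%:E.
Proof.
move=> Ar Amax; rewrite /supremum; case: ifPn => [/eqP E|_].
  by have : [set (j%:Z)%:E | j in A] (r%:Z)%:E; [exists r|rewrite E].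
have supr : supremums [set (j%:Z)%:E | j in A] (r%:Z)%:E.
  split=> [_ [j Aj <-]|y uy]; first by rewrite lee_fin lez_nat Amax.
  by apply: uy; exists r.
by case: xgetP => [y _ /is_subset1_supremums/(_ supr)|/(_ _ supr)].
Qed.

Lemma infimum_nat x A r : A r -> (forall s, A s -> (r <= s)%N) ->
  infimum x [set (j%:Z)%:E | j in A] = (r%:Z)%:E.
Proof.
move=> Ar Amin; rewrite /infimum; case: ifPn => [/eqP E|_].
  by have : [set (j%:Z)%:E | j in A] (r%:Z)%:E; [exists r|rewrite E].
have infr : infimums [set (j%:Z)%:E | j in A] (r%:Z)%:E.
  split=> [_ [j Aj <-]|y uy]; first by rewrite lee_fin lez_nat Amin.
  by apply: uy; exists r.
by case: xgetP => [y _ /is_subset1_infimums/(_ infr)|/(_ _ infr)].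
Qed.

(** [supremum] takes a default value unless a least upper bound exists; one is exhibited, the
    maximum of a bounded set and +oo for an unbounded one. *)
Lemma le_supremum_nat x A r : A r -> ((r%:Z)%:E <= supremum x [set (j%:Z)%:E | j in A])%E.
Proof.
move=> Ar; apply: ge_supremum_Nmem; last by exists r.
case: (pselect (exists N, forall s, A s -> (s <= N)%N)) => [[N AN]|unb].
  have ex : exists s, `[<A s>] by exists r; apply/asboolP.
  have bd s : `[<A s>] -> (s <= N)%N by move=> /asboolP/AN.
  case: (ex_maxnP ex bd) => M /asboolP AM Mmax; exists (M%:Z)%:E.
  split=> [_ [j Aj <-]|y uy]; last by apply: uy; exists M.
  by rewrite lee_fin lez_nat Mmax //; apply/asboolP.
exists +oo%E; split=> [y _|[z||] uy]; rewrite ?leey //.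
  exfalso; apply: unb; exists `|z|%N => s As.
  have : ((s%:Z)%:E <= z%:E)%E by apply: uy; exists s.
  by rewrite lee_fin; lia.
by have := uy _ (ex_intro2 _ _ r Ar erefl).
Qed.

End Suprema.

Section KrullDimension.
Variable R : comNzRingType.
Implicit Types (A : set R).

Lemma krull_dim_ge A d C : prime_chain A d C -> ((d%:Z)%:E <= krull_dim A)%E.
Proof. by move=> HC; apply: le_supremum_nat; exists C. Qed.

Lemma krull_dim1 A : A 1 -> krull_dim A = -oo%E.
Proof.
move=> A1; rewrite /krull_dim; set K := [set d : nat | _].
have -> : K = set0; last by rewrite image_set0 supremum0.
apply/seteqP; split=> // d [C [/(_ 0%N (leq0n _))[pC AC] _]].
exact: (prime_ideal1 pC (AC _ A1)).
Qed.

End KrullDimension.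

(** * The values of the two invariants *)

Section Invariants.
Variables (k : fieldType) (n : nat) (D : {set {set 'I_n}}) (l : nat).
Local Notation S := {mpoly k[n]}.
Local Notation I := (fat (k := k) D l).
Hypothesis hD : simplicial_complex D.
Hypothesis hdim : complex_dim D = 1%R.
Hypothesis l0 : (0 < l)%N.

Let facet0 := facet_neq0 hD hdim.

Lemma card_facet F : facet D F -> (0 < #|F| <= 2)%N.
Proof. by move=> fF; have [FD _] := fF; rewrite card_gt0 (facet0 fF) (card_face hdim FD). Qed.

(** This is what frees the depth inequality from a purity assumption. *)
Lemma connected_pure : ~ disconnected D l -> forall F, facet D F -> #|F| = 2%N.
Proof.
move=> conn F fF; have := card_facet fF.
have : #|F| <> 1%N by move=> F1; apply/conn/(disconnected_isolated hD hdim fF F1 l0).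
by case: #|F| => [|[|[|]]].
Qed.

(** Upper bounds: a longer regular sequence would kill the class in H^2, or in the disconnected case
    the class in H^1. Lower bounds: [esym1], followed by [esym2] in the connected case. *)
Lemma depth_fat : depth I = (if `[<disconnected D l>] then 1 else 2)%:E.
Proof.
have iI : ideal I := fat_ideal k D l.
pose A := [set r : nat | exists2 fs : seq S,
  (forall f, f \in fs -> max_ideal f) /\ regular_sequence I fs & size fs = r].
have -> : depth I = supremum +oo%E [set (j%:Z)%:E | j in A].
  rewrite /depth; congr supremum; apply/seteqP; split=> y /=.
    by move=> [fs Hfs <-]; exists (size fs) => //; exists fs.
  by move=> [_ [fs Hfs <-] <-]; exists fs.
have A2 r : A r -> (r <= 2)%N.
  move=> [fs [mfs rfs] <-]; rewrite leqNgt; apply/negP => lt.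
  have [E ED E2] := exists_edge hD hdim.
  have [phi [_ phi0 _] Hphi] := top_class k card_facet (edge_facet hdim ED E2) E2 l0.
  have [u zu] := Hphi 1 (@thick1_1 k n E).
  rewrite cech_scale1 phi0 ?eqxx //.
  exact: (regular_sequence_cech iI mfs rfs lt zu).
case: asboolP => [disc|conn].
  apply: (@supremum_nat _ _ 1%N) => [|_ [fs [mfs rfs] <-]].
    exists [:: esym1 k n] => //; split; last exact: regular_sequence1.
    by move=> f; rewrite inE => /eqP ->; apply: max_ideal_esym1.
  rewrite leqNgt; apply/negP => lt.
  have [u [phi [[_ phi0 _] zu Hphi]]] := disconnected_class k card_facet disc.
  have := Hphi 1; rewrite cech_scale1 phi0 ?mcoeff1 ?eqxx => [/esym/eqP|].
    by rewrite oner_eq0.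
  exact: (regular_sequence_cech iI mfs rfs lt zu).
apply: (@supremum_nat _ _ 2%N) => //.
exists [:: esym1 k n; esym2 k n] => //; split.
  move=> f; rewrite !inE => /orP[] /eqP ->; [exact: max_ideal_esym1|exact: max_ideal_esym2].
by apply: regular_sequence2 => //; apply: connected_pure.
Qed.

Lemma lc_dual_ann_disconnected : disconnected D l ->
  lc_dual_ann I 1 `<=` thick finset.set0 1.
Proof.
move=> /(disconnected_class k card_facet)[u [phi [phiD zu Hphi]]] f Af.
apply/thickP => m; rewrite ltnS leqn0 => /eqP wm.
have -> : m = 0%MM.
  apply/mnmP => i; rewrite mnm0E; apply/eqP.
  by move/eqP: wm; rewrite sum_nat_eq0 => /forall_inP; apply; rewrite !inE.
by rewrite -Hphi; apply: Af.
Qed.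

Lemma lc_dual_ann_top E : facet D E -> #|E| = 2%N -> lc_dual_ann I 2 `<=` thick E 1.
Proof.
move=> fE E2 f Af; apply: contrapT => nf.
have [phi phiD Hphi] := top_class k card_facet fE E2 l0.
by have [u zu] := Hphi f nf; rewrite (Af phi phiD u zu) eqxx.
Qed.

Lemma thick_ltset0 (E : {set 'I_n}) :
  E != finset.set0 -> thick (k := k) E 1 `<` thick finset.set0 1.
Proof.
move=> /finset.set0Pn[i iE]; split=> [p Hp m /Hp|].
  rewrite !wt_supp; apply: contra => /fintype.subset_trans; apply.
  exact: finset.sub0set.
by move=> /(_ 'X_i) H; have /thickX := H (ltac:(by apply/thickX; rewrite wtU inE)); rewrite wtU iE.
Qed.

Lemma lc_dual_ann1 j : (forall u, cech_cocycle I j u -> cech_coboundary I j u) ->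
  lc_dual_ann I j 1.
Proof.
by move=> H phi [_ phi0 _] u zu; rewrite cech_scale1 phi0 //; apply: H.
Qed.

(** The thresholds j - 2 + 1 for j = 0, 1, 2 are -1, 0, 1. As K^0 = 0 has dimension -oo, j = 0
    fails; j = 1 succeeds exactly if K^1 is nonzero, its annihilator then lying in the maximal
    ideal; j = 2 always succeeds, by the chain from the prime of an edge to the maximal ideal. *)
Lemma Sr_depth_fat : pure_complex D ->
  Sr_depth 2 I = (if `[<disconnected D l>] then 1 else 2)%:E.
Proof.
move=> pD; have [E ED E2] := exists_edge hD hdim.
have fE := edge_facet hdim ED E2.
have pureD F : facet D F -> #|F| = 2%N.
  by move=> fF; have := pD F E fF fE; rewrite /face_dim E2; lia.
pose m0 := thick (k := k) (n := n) finset.set0 1.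
have ge1 j : (((j%:Z - 2%:Z + 1)%:E <= lc_dual_dim I j)%E) -> (0 < j)%N.
  case: j => // H; exfalso; move: H; rewrite /lc_dual_dim krull_dim1 //.
  by apply: lc_dual_ann1 => u; apply: cech_cocycle0.
have two : ((2%:Z - 2%:Z + 1)%:E <= lc_dual_dim I 2)%E.
  apply: (@krull_dim_ge _ _ 1 (fun i => if i is 0%N then thick E 1 else m0)).
  have Esub := thick_ltset0 (facet0 fE).
  split=> [[|i] _|[|//] _] //; first by split; [exact: thick_prime|exact: lc_dual_ann_top].
  split; first exact: thick_prime.
  by apply: subset_trans (lc_dual_ann_top fE E2) _; case: Esub.
rewrite /Sr_depth; case: asboolP => [disc|conn].
  apply: infimum_nat => //.
  apply: (@krull_dim_ge _ _ 0 (fun=> m0)); split=> // i _.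
  split; [exact: thick_prime|exact: lc_dual_ann_disconnected].
apply: infimum_nat => // -[|[|j]] // H; first exact: ge1 H.
exfalso; move: H; rewrite /= /lc_dual_dim krull_dim1 //.
by apply: lc_dual_ann1 => u; apply: cech_cocycle1.
Qed.

End Invariants.

Theorem theorem1p7 (k : fieldType) (n : nat) (D : {set {set 'I_n}}) (l : nat)
    (hD : simplicial_complex D) (hdim : complex_dim D = 1%R) (hl : (1 <= l)%N) :
  (depth (symbolic_power (stanley_reisner k D) l.+1)
     <= depth (symbolic_power (stanley_reisner k D) l))%E /\
  (pure_complex D ->
   (Sr_depth 2 (symbolic_power (stanley_reisner k D) l.+1)
      <= Sr_depth 2 (symbolic_power (stanley_reisner k D) l))%E).
Proof.
have discS : disconnected D l -> disconnected D l.+1.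
  (* If level l + 1 were connected, [D] would be pure, and [disconnectedS] would apply. *)
  case: (pselect (disconnected D l.+1)) => // conn.
  by apply: disconnectedS => //; apply: connected_pure conn.
have le12 : (((if `[<disconnected D l.+1>] then 1 else 2 : int)%:E : \bar int) <=
    (if `[<disconnected D l>] then 1 else 2)%:E)%E.
  by rewrite lee_fin; case: asboolP => [_|conn]; case: asboolP => // /discS.
rewrite !symbolic_power_fat //; split=> [|pD]; first by rewrite !depth_fat.
by rewrite !Sr_depth_fat.
Qed.
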